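(* Let $(X,f)$ be a topological dynamical system and let $\varphi,\psi\in C(X,\mathbb{R})$ with $\psi>0$. Then $$P_{\psi}(\varphi)=\sup\left\{\frac{h_{\nu}(f)}{\int \psi\, d\nu}+\frac{\int \varphi\, d\nu}{\int \psi\, d\nu}:\ \nu\in M(X,f)\right\},$$ where $P_\psi(\varphi)$ is the $\psi$-induced topological pressure of $\varphi$.
   Context: A topological dynamical system (TDS) $(X,f)$ is a compact metric space $(X,d)$ together with a continuous map $f:X\to X$. $C(X,\mathbb{R})$ is the space of continuous real-valued functions on $X$ with the supremum norm. $M(X,f)$ is the set of $f$-invariant Borel probability measures on $X$, and $h_\nu(f)\in[0,\infty]$ is the measure-theoretic (Kolmogorov–Sinai) entropy of $\nu\in M(X,f)$. For $n\ge 1$, $(S_n\varphi)(x)=\sum_{i=0}^{n-1}\varphi(f^i x)$. Here $\mathbb{N}=\{1,2,\dots\}$. For $n\in\mathbb{N}$, $d_n(x,y)=\max\{d(f^i(x),f^i(y)): i=0,\dots,n-1\}$. For $Z\subseteq X$ and $\epsilon>0$, a set $F_n\subset X$ is an $(n,\epsilon)$-spanning set of $Z$ if for every $y\in Z$ there is $x\in F_n$ with $d_n(x,y)\le\epsilon$. Induced topological pressure: let $\varphi,\psi\in C(X,\mathbb{R})$ with $\psi>0$. For $T>0$ put $$S_T=\{n\in\mathbb{N}: \exists x\in X \text{ such that } S_n\psi(x)\le T \text{ and } S_{n+1}\psi(x)>T\},$$ and for $n\in S_T$ put $X_n=\{x\in X: S_n\psi(x)\le T \text{ and } S_{n+1}\psi(x)>T\}$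 (which depends on $T$; $S_T$ is a finite set). Let $$Q_{\psi,T}(f,\varphi,\epsilon)=\inf\Big\{\sum_{n\in S_T}\sum_{x\in F_n}\exp\big((S_n\varphi)(x)\big): F_n \text{ is an } (n,\epsilon)\text{-spanning set of } X_n \text{ for each } n\in S_T\Big\}.$$ The $\psi$-induced topological pressure of $\varphi$ (with respect to $f$) is $$P_\psi(\varphi)=\lim_{\epsilon\to0}\limsup_{T\to\infty}\frac1T\log Q_{\psi,T}(f,\varphi,\epsilon),$$ where the limit in $\epsilon$ exists (possibly $+\infty$) by monotonicity. *)

(* Defs.v *)
From HB Require Import structures.
From mathcomp Require Import all_boot all_order all_algebra.
From mathcomp Require Import all_classical all_reals all_analysis.
Set Implicit Arguments.
Unset Strict Implicit.
Unset Printing Implicit Defensive.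
Import Order.TTheory GRing.Theory Num.Theory.
Import numFieldNormedType.Exports.
Local Open Scope classical_set_scope.
Local Open Scope ring_scope.

(* [measurableType] requires a distinguished point, hence nonempty spaces. *)
#[short(type="pmetricType")]
HB.structure Definition PointedMetric (R : numDomainType) :=
  {T of Metric R T & Pointed T}.

Notation borel X := (g_sigma_algebraType (@open X)).

Section Dynamics.
Context {R : realType} {X : pmetricType R}.
Implicit Types (f : X -> X) (phi psi : X -> R) (nu : probability (borel X) R).

Definition birkhoff_sum f phi (n : nat) (x : X) : R :=
  \sum_(i < n) phi (iter i f x).

(* Distances being nonnegative, the default 0 only matters for n = 0. *)
Definition bowen_dist f (n : nat) (x y : X) : R :=
  \big[Num.max/0]_(i < n) mdist (iter i f x) (iter i f y).

Definition spanning f (n : nat) (eps : R) (Z F : set X) : Prop :=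
  forall y, Z y -> exists2 x, F x & bowen_dist f n x y <= eps.

Definition invariant_measures f : set (probability (borel X) R) :=
  [set nu | forall A : set (borel X), measurable A -> nu (f @^-1` A) = nu A].

(* Cells may be empty: they do not contribute to the entropy. *)
Definition finite_partition (k : nat) (P : 'I_k -> set X) : Prop :=
  [/\ forall j, measurable (P j : set (borel X)),
      trivIset [set: 'I_k] P
    & \bigcup_j P j = [set: X]].

(* The s-th cell of the join of the preimages of P under f^0, ..., f^(n-1). *)
Definition join_cell f (k : nat) (P : 'I_k -> set X) (n : nat)
    (s : {ffun 'I_n -> 'I_k}) : set X :=
  [set x | forall i : 'I_n, P (s i) (iter i f x)].

(* Here 0 * ln 0 = 0. *)
Definition partition_entropy nu (I : finType) (P : I -> set X) : R :=
  - \sum_(j : I) fine (nu (P j)) * ln (fine (nu (P j))).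

Definition entropy_wrt nu f (k : nat) (P : 'I_k -> set X) : R :=
  limn (fun n => n%:R^-1 * partition_entropy nu (@join_cell f k P n)).

Definition ks_entropy nu f : \bar R :=
  ereal_sup [set e | exists k : nat, exists2 P : 'I_k -> set X,
    finite_partition P & e = (entropy_wrt nu f P)%:E].

Definition exit_set f psi (T : R) (n : nat) : set X :=
  [set x | birkhoff_sum f psi n x <= T /\ T < birkhoff_sum f psi n.+1 x].

Definition exit_times f psi (T : R) : set nat :=
  [set n | (0 < n)%N /\ exit_set f psi T n !=set0].

(* The spanning sets may be infinite, so the sums of the positive terms
   exp (S_n phi) are taken in the extended reals. *)
Definition induced_Q f psi phi (T eps : R) : \bar R :=
  ereal_inf [set
    \esum_(n in exit_times f psi T)
      \esum_(x in F n) (expR (birkhoff_sum f phi n x))%:E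
    | F in [set F : nat -> set X | forall n, exit_times f psi T n ->
              spanning f n eps (exit_set f psi T n) (F n)]].

Definition induced_pressure f psi phi : \bar R :=
  lim ((fun eps : R =>
    limf_esup (fun T : R => (T^-1)%:E * lne (induced_Q f psi phi T eps))%E
      (pinfty_nbhs R)) @ 0^'+).

End Dynamics.

(* Main.v *)
From HB Require Import structures.
Require Import Defs.
From mathcomp Require Import all_boot all_order all_algebra finmap.
From mathcomp Require Import all_classical all_reals all_analysis measurable_realfun.
From mathcomp Require Import ring lra.
Import Order.TTheory GRing.Theory Num.Theory.
Import numFieldNormedType.Exports.
Local Open Scope classical_set_scope.
Local Open Scope ring_scope.

Set Implicit Arguments.
Unset Strict Implicit.
Unset Printing Implicit Defensive.

(** The induced pressure is the root in [b] of the classical pressure of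
    [phi - b psi], and the free energy of [phi - b psi] at an invariant
    measure [nu] is nonpositive exactly when the ratio at [nu] is at most [b]
    ([ratio_le]).  So both sides of the formula can be compared with an arbitrary
    real [b], and the classical variational principle does the rest.

    Root.  If [x] leaves the level [T] at time [n], then [S_n psi x] is [T] up to a
    bounded error, hence [exp (S_n phi x)] is [exp (b T)] times
    [exp (S_n (phi - b psi) x)] up to a bounded factor.  If the sums of
    [exp (S_n (phi - b psi))] over separated sets decay exponentially in [n], then
    adding them over [n] gives [Q_T <= C exp (b T)], which is at most [exp (b' T)] for
    large [T] if [b < b'] ([induced_Q_le]).  Conversely, each orbit leaves at time [n]
    one of the multiples of a lower bound of [psi], so that the spanning sets that
    realize [Q_T < exp (b T)] for these levels together span the space at time [n]
    ([growth_of_induced_Q]).  The spanning sets need not lie in the exit sets, which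
    costs a factor [exp (n d)] with [d] controlled by the modulus of continuity of
    [psi].

    Entropy is at most the growth rate ([entropy_le_growth]).  Split every cell of
    the partition into a closed core and a rest of small measure.  By Gibbs'
    inequality, the entropy of the split partition up to time [n], plus the integral
    of [S_n g], is at most the logarithm of a sum over the words, in which every
    visit to a rest is given the weight [kappa], plus [ln (1 / kappa)] times the mean
    number of these visits.  The cores are at positive distance, so that a point of
    a spanning set determines all the cores visited by the orbits that it shadows,
    and the sum over the words is at most [(1 + k kappa) ^ n] times the sum over the
    spanning set.  As [kappa] is chosen before the cores, both errors are arbitrarily
    small.

    The growth rate is attained ([entropy_ge_separated]).  Weight the points of
    separated sets by [exp (S_n g)], average along the orbits, and take the limit along
    an ultrafilter: this gives an invariant finitely additive probability on all
    subsets, which is represented by a Borel measure [nu] through its values on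
    closed sets ([representing_probability]).  The two agree on the sets whose
    boundary is [nu]-null, and there are fine partitions into such sets.  Points of a
    separated set have distinct words, so Gibbs' inequality for the product of the
    laws of blocks of length [q], averaged over the starting position of the blocks
    ([separated_sum_bound]), bounds the growth rate by the entropy of [nu] on the
    words of length [q], divided by [q]. *)

(** * Finite sums, Gibbs' inequality and subadditive sequences *)

Lemma sum_inj_le (R : realType) (I J : finType) (h : I -> J) (F : J -> R) :
  injective h -> (forall j, 0 <= F j) -> \sum_i F (h i) <= \sum_j F j.
Proof.
move=> h_inj F0; have -> : \sum_i F (h i) = \sum_(j in [set h i | i in I]%SET) F j.
  by rewrite big_imset //= => i j _ _; exact: h_inj.
by rewrite [leRHS](bigID (mem [set h i | i in I]%SET))/= lerDl sumr_ge0.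
Qed.

Lemma gibbs_term (R : realType) (p q Z : R) : 0 <= p -> 0 <= q -> 0 < Z ->
  (q = 0 -> p = 0) -> p * ln q - p * ln p - p * ln Z <= q / Z - p.
Proof.
move=> p0 q0 Z0 qp; have [->|pn0] := eqVneq p 0.
  by rewrite !mul0r !subr0 divr_ge0 // ltW.
have {}p0 : 0 < p by rewrite lt_neqAle eq_sym pn0.
have {qp}q0 : 0 < q.
  rewrite lt_neqAle q0 andbT; apply: contra_neq pn0 => q0'; exact: qp.
rewrite -!mulrBr -ln_div ?posrE // -ln_div ?posrE ?divr_gt0 //.
have -> : q / Z - p = p * (q / p / Z - 1).
  by field; rewrite !gt_eqF.
rewrite ler_pM2l //; have := @le_ln1Dx R (q / p / Z - 1).
by rewrite [X in ln X]addrC subrK; apply; rewrite ltrBrDl addrN !divr_gt0.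
Qed.

(** Concavity of the logarithm, used as [ln t <= t - 1] for [t = q i / (p i Z)],
    where [Z] is the total weight.  All the entropy bounds below follow by a choice
    of the weights [q]. *)
Lemma gibbs (R : realType) (I : finType) (p q : I -> R) (K : R) :
  (forall i, 0 <= p i) -> (forall i, 0 <= q i) ->
  (forall i, q i = 0 -> p i = 0) -> \sum_i p i = 1 ->
  \sum_i q i <= K ->
  - \sum_i p i * ln (p i) <= ln K - \sum_i p i * ln (q i).
Proof.
move=> p0 q0 qp p1; set Z := \sum_i q i => ZK.
have Z0 : 0 < Z.
  rewrite lt_neqAle sumr_ge0 // andbT; apply/eqP => /esym Z0.
  have q_0 i : q i = 0.
    by apply/eqP; have := Z0 => /eqP; rewrite psumr_eq0 // => /allP; apply; rewrite mem_index_enum.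
  by move: p1; rewrite big1 => [/eqP|i _]; [rewrite eq_sym oner_eq0|exact: qp].
have lnZK : ln Z <= ln K by rewrite ler_ln ?posrE // (lt_le_trans Z0).
have : \sum_i (p i * ln (q i) - p i * ln (p i) - p i * ln Z) <=
    \sum_i (q i / Z - p i).
  by apply: ler_sum => i _; apply: gibbs_term => //; exact: qp.
rewrite !sumrB -!mulr_suml p1 mul1r -/Z divff ?gt_eqF // subrr.
by lra.
Qed.

(** Divide [n] by an index [m] at which [u m / m] nearly attains its infimum. *)
Lemma fekete (R : realType) (u : nat -> R) : (forall n, 0 <= u n) ->
  (forall m n, u (m + n)%N <= u m + u n) -> cvgn (fun n => n%:R^-1 * u n).
Proof.
move=> u0 usub.
pose S := [set n.+1%:R^-1 * u n.+1 | n in [set: nat]].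
have Slb : has_lbound S by exists 0 => _ [n _ <-]; rewrite mulr_ge0 // invr_ge0.
have Sinf : has_inf S by split => //; exists (1%:R^-1 * u 1%N), 0%N.
have L0 : 0 <= inf S.
  by apply: lb_le_inf; [exact: Sinf.1|move=> _ [n _ <-]; rewrite mulr_ge0 // invr_ge0].
have umul m q : u (q * m)%N <= q%:R * u m + u 0%N.
  elim: q => [|q IH]; first by rewrite mul0n mul0r add0r.
  rewrite mulSn -natr1 mulrDl mul1r; apply: le_trans (usub _ _) _.
  by rewrite addrC addrAC lerD2r.
apply/cvg_ex; exists (inf S); apply/cvgrPdist_le => /= e e0.
have [_ [m _ <-] mS] := @inf_adherent _ S (e / 2) (divr_gt0 e0 (ltr0n _ 2)) Sinf.
pose c := u 0%N + (u 0%N + m.+1%:R * u 1%N).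
near=> n.
have n0 : (0 < n)%N by near: n; exists 1%N.
have nR : (0 : R) < n%:R by rewrite ltr0n.
have lo : inf S <= n%:R^-1 * u n.
  by apply: ge_inf => //; exists n.-1 => //; rewrite prednK.
rewrite ler0_norm ?subr_le0 // opprB lerBlDl.
have ur : u (n %% m.+1)%N <= u 0%N + m.+1%:R * u 1%N.
  have := umul 1%N (n %% m.+1)%N; rewrite muln1 addrC => /le_trans; apply.
  by rewrite lerD2l ler_wpM2r // ler_nat ltnW // ltn_mod.
have un : u n <= (n %/ m.+1)%:R * u m.+1 + c.
  rewrite [in leLHS](divn_eq n m.+1); apply: le_trans (usub _ _) _.
  by rewrite /c addrA lerD // addrC; apply: le_trans (umul _ _) _; rewrite addrC.
have um : (n %/ m.+1)%:R * u m.+1 <= n%:R * (m.+1%:R^-1 * u m.+1).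
  rewrite mulrA ler_wpM2r // ler_pdivlMr ?ltr0n // -natrM ler_nat.
  exact: leq_divM.
rewrite mulrC ler_pdivrMr //; apply: le_trans un _.
have nc : c <= n%:R * (e / 2).
  rewrite -ler_pdivrMr ?divr_gt0 // .
  near: n; exact: nbhs_infty_ger.
apply: le_trans (lerD um nc) _; rewrite -mulrDr mulrC ler_pM2r //.
by rewrite [X in _ <= _ + X]splitr addrA lerD2r ltW.
Unshelve. all: by end_near.
Qed.

(** * Borel probability measures and finite measurable partitions *)

Notation borel_set A := (measurable (A : set (borel _))).

Section Mass.
Context {R : realType} {X : pmetricType R}.
Implicit Types (nu : probability (borel X) R) (A B : set X).

Lemma open_borel A : open A -> borel_set A.
Proof. exact: sub_sigma_algebra. Qed.

Lemma closed_borel A : closed A -> borel_set A.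
Proof.
by move=> cA; rewrite -[A]setCK; apply: measurableC;
  exact: (open_borel (closed_openC cA)).
Qed.

Lemma continuous_borel_preimage (f : X -> X) A : continuous f ->
  borel_set A -> borel_set (f @^-1` A).
Proof.
move=> cf mA; have /continuousP ocf := cf.
have mf : measurable_fun [set: borel X] (f : borel X -> borel X).
  apply: (@measurability _ _ (borel X) (borel X) setT f (@open X)) => // _ [B oB <-].
  by rewrite setTI; apply: open_borel; exact: ocf.
by have := mf (@measurableT _ (borel X)) A mA; rewrite setTI.
Qed.

Lemma continuous_borel_fun (g : X -> R) : continuous g ->
  measurable_fun [set: borel X] (g : borel X -> R).
Proof.
move=> /continuousP ocg.
apply: (@measurability _ _ (borel X) R setT g _ (measurable_realfun.RGenOpens.measurableE R)).
move=> _ [_ [x [y ->]] <-]; rewrite setTI; apply: open_borel; apply: ocg.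
exact: interval_open.
Qed.

Lemma iter_continuous (f : X -> X) n : continuous f -> continuous (iter n f).
Proof.
move=> cf; elim: n => [|n IH] x; first exact: cvg_id.
by apply: continuous_comp; [exact: IH|exact: cf].
Qed.

Definition mass nu A : R := fine (nu A).

Lemma massE nu A : borel_set A -> nu A = (mass nu A)%:E.
Proof. by move=> mA; rewrite /mass fineK // fin_num_measure. Qed.

Lemma mass_ge0 nu A : 0 <= mass nu A.
Proof. exact: fine_ge0. Qed.

Lemma le_mass nu A B : borel_set A -> borel_set B -> A `<=` B ->
  mass nu A <= mass nu B.
Proof.
by move=> mA mB AB; rewrite -lee_fin -!massE //; apply: le_measure; rewrite ?inE.
Qed.

Lemma massT nu : mass nu setT = 1.
Proof. by rewrite /mass probability_setT. Qed.

Lemma mass0 nu : mass nu set0 = 0.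
Proof. by rewrite /mass measure0. Qed.

Lemma mass_le1 nu A : borel_set A -> mass nu A <= 1.
Proof. by move=> mA; rewrite -(massT nu) le_mass. Qed.

Lemma massU nu A B : borel_set A -> borel_set B -> A `&` B = set0 ->
  mass nu (A `|` B) = mass nu A + mass nu B.
Proof.
move=> mA mB AB; apply: EFin_inj; rewrite EFinD -!massE //; last exact: measurableU.
exact: measureU.
Qed.

Lemma mass_setC nu A : borel_set A -> mass nu (~` A) = 1 - mass nu A.
Proof.
move=> mA; rewrite -(massT nu) -(setUv A) massU // ?setICr //; last exact: measurableC.
by rewrite addrAC subrr add0r.
Qed.

Lemma massD nu A B : borel_set A -> borel_set B -> A `<=` B ->
  mass nu (B `\` A) = mass nu B - mass nu A.
Proof.
move=> mA mB AB; rewrite -[in X in _ = X - _](setDUK AB) massU //.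
- by rewrite addrAC subrr add0r.
- exact: measurableD.
- exact: setDIK.
Qed.

Lemma mass_le_D nu A B : borel_set A -> borel_set B ->
  mass nu B <= mass nu A + mass nu (B `\` A).
Proof.
move=> mA mB; have mD : borel_set (B `\` A) by exact: measurableD.
rewrite -massU // ?setDIK // le_mass //; first exact: measurableU.
by move=> x Bx; have [Ax|nAx] := pselect (A x); [left|right].
Qed.

Lemma massU_le nu A B : borel_set A -> borel_set B ->
  mass nu (A `|` B) <= mass nu A + mass nu B.
Proof.
move=> mA mB; have mU : borel_set (A `|` B) by exact: measurableU.
apply: le_trans (mass_le_D nu mA mU) _; rewrite lerD2l; apply: le_mass => //.
  exact: measurableD.
by move=> x [[]].
Qed.

Lemma mass_null_sub nu A B : borel_set A -> borel_set B -> A `<=` B ->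
  mass nu B = 0 -> mass nu A = 0.
Proof.
by move=> mA mB AB B0; apply/eqP; rewrite eq_le mass_ge0 andbT -B0 le_mass.
Qed.

Lemma mass_bigcup (I : finType) nu (P : I -> set X) :
  (forall i, borel_set (P i)) -> trivIset [set: I] P ->
  mass nu (\bigcup_i P i) = \sum_i mass nu (P i).
Proof.
move=> mP tP; apply: EFin_inj.
rewrite -massE; last by apply: fin_bigcup_measurable => //; exact: finite_finset.
rewrite measure_fin_bigcup //; last exact: finite_finset.
have -> : [set: I] = [set` index_enum I].
  by apply/seteqP; split => i //= _; rewrite mem_index_enum.
rewrite -fsbig_seq ?index_enum_uniq // -sumEFin.
by apply: eq_bigr => i _; exact: massE.
Qed.

End Mass.

(** * Entropy of finite measurable partitions *)

Section Entropy.
Context {R : realType} {X : pmetricType R}.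
Implicit Types (nu : probability (borel X) R) (f : X -> X).

(** This is [finite_partition] for any finite index type: the partitions below are
    also indexed by words and by pairs. *)
Definition is_partition (I : finType) (P : I -> set X) : Prop :=
  [/\ forall i, borel_set (P i), trivIset [set: I] P & \bigcup_i P i = setT].

(** This is [join_cell] for partitions indexed by any finite type; the two are
    convertible on ordinals. *)
Definition join (I : finType) f (P : I -> set X) (n : nat)
    (s : {ffun 'I_n -> I}) : set X :=
  [set x | forall i : 'I_n, P (s i) (iter i f x)].

Lemma partition_index (I : finType) (P : I -> set X) : is_partition P ->
  exists c : X -> I, forall x i, P i x <-> c x = i.
Proof.
move=> [_ tP cP]; have : forall x, exists i, P i x.
  by move=> x; have : [set: X] x by []; rewrite -cP => -[i _ Pi]; exists i.
move=> /choice[c cPx]; exists c => x i; split => [Pix|<-//].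
by apply: tP => //; exists x; split.
Qed.

Lemma mass_partition (I : finType) nu (P : I -> set X) A : is_partition P ->
  borel_set A -> mass nu A = \sum_i mass nu (A `&` P i).
Proof.
move=> [mP tP cP] mA; rewrite -mass_bigcup.
- by rewrite -setI_bigcupr cP setIT.
- by move=> i; exact: measurableI.
- exact: trivIset_setIl.
Qed.

Lemma sum_mass_partition (I : finType) nu (P : I -> set X) : is_partition P ->
  \sum_i mass nu (P i) = 1.
Proof.
move=> pP; rewrite -(massT nu) (mass_partition nu pP) //.
by apply: eq_bigr => i _; rewrite setTI.
Qed.

Lemma mass_coarse (I J : finType) nu (P : I -> set X) (Q : J -> set X)
    (h : J -> I) : is_partition P -> is_partition Q ->
  (forall j, Q j `<=` P (h j)) ->
  forall i, mass nu (P i) = \sum_(j | h j == i) mass nu (Q j).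
Proof.
move=> pP pQ QP i; rewrite (mass_partition nu pQ) //; last by case: pP.
rewrite [RHS]big_mkcond; apply: eq_bigr => j _; case: eqP => [<-|hij].
  by congr mass; apply/setIidPr.
rewrite (_ : _ `&` _ = set0) ?mass0 //; apply/seteqP; split => // x [Px Qx].
apply: hij; case: pP => _ tP _; apply: tP => //.
by exists x; split => //; exact: QP.
Qed.

Lemma expect_coarse (I J : finType) nu (P : I -> set X) (Q : J -> set X)
    (h : J -> I) (F : I -> R) : is_partition P -> is_partition Q ->
  (forall j, Q j `<=` P (h j)) ->
  \sum_i mass nu (P i) * F i = \sum_j mass nu (Q j) * F (h j).
Proof.
move=> pP pQ QP; rewrite [RHS](partition_big h xpredT) //=.
apply: eq_bigr => i _; rewrite (mass_coarse nu pP pQ QP) mulr_suml.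
by apply: eq_bigr => j /eqP->.
Qed.

Lemma partition_entropyE (I : finType) nu (P : I -> set X) :
  partition_entropy nu P = - \sum_i mass nu (P i) * ln (mass nu (P i)).
Proof. by []. Qed.

Lemma ln_mass_le0 nu A : borel_set A -> ln (mass nu A) <= 0.
Proof. by move=> mA; apply: ln_le0; exact: mass_le1. Qed.

Lemma partition_entropy_ge0 (I : finType) nu (P : I -> set X) :
  is_partition P -> 0 <= partition_entropy nu P.
Proof.
move=> [mP _ _]; rewrite partition_entropyE oppr_ge0; apply: sumr_le0 => i _.
by rewrite mulr_ge0_le0 ?mass_ge0 ?ln_mass_le0.
Qed.

(** The logarithm is increasing and a fine cell is no heavier than the coarse cell
    that contains it. *)
Lemma partition_entropy_refine (I J : finType) nu (P : I -> set X)
    (Q : J -> set X) (h : J -> I) : is_partition P -> is_partition Q ->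
  (forall j, Q j `<=` P (h j)) -> partition_entropy nu P <= partition_entropy nu Q.
Proof.
move=> pP pQ QP; rewrite !partition_entropyE lerN2.
rewrite (expect_coarse nu (fun i => ln (mass nu (P i))) pP pQ QP).
apply: ler_sum => j _; have := mass_ge0 nu (Q j).
rewrite le_eqVlt => /orP[/eqP<-|Qj0]; first by rewrite !mul0r.
rewrite ler_pM2l //; case: pP pQ => mP _ _ [mQ _ _].
have le := le_mass nu (mQ j) (mP (h j)) (QP j).
by rewrite ler_ln ?posrE // (lt_le_trans Qj0).
Qed.

Lemma join_partition (I : finType) f (P : I -> set X) n : continuous f ->
  is_partition P -> is_partition (@join I f P n).
Proof.
move=> cf pP; have [c cP] := partition_index pP; have [mP tP uP] := pP; split.
- move=> s; rewrite (_ : join f P s =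
    \bigcap_(i in [set: 'I_n]) (iter i f @^-1` P (s i))).
    apply: fin_bigcap_measurable => [|i _]; first exact: finite_finset.
    by apply: continuous_borel_preimage => //; exact: iter_continuous.
  by apply/seteqP; split => x /= H i; [move=> _|]; exact: H.
- move=> s t _ _ [x [sx tx]]; apply/ffunP => i.
  by move: (sx i) (tx i) => /cP <- /cP <-.
- apply/seteqP; split => // x _; exists [ffun i : 'I_n => c (iter i f x)] => //.
  by move=> i; rewrite ffunE; apply/cP.
Qed.

Lemma mass_preimage nu f A : invariant_measures f nu -> borel_set A ->
  mass nu (f @^-1` A) = mass nu A.
Proof. by move=> inv mA; rewrite /mass inv. Qed.

Lemma mass_preimage_iter nu f A n : continuous f -> invariant_measures f nu ->
  borel_set A -> mass nu (iter n f @^-1` A) = mass nu A.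
Proof.
move=> cf inv mA; elim: n => [//|n IH]; rewrite -[RHS]IH.
rewrite -[RHS](mass_preimage inv); last first.
  by apply: continuous_borel_preimage => //; exact: iter_continuous.
by congr mass; apply/seteqP; split => x /=; rewrite -iterS iterSr.
Qed.

Lemma preimage_partition (I : finType) f (P : I -> set X) : continuous f ->
  is_partition P -> is_partition (fun i => f @^-1` P i).
Proof.
move=> cf [mP tP uP]; split => [i|i j _ _ [x [Pi Pj]]|].
- exact: continuous_borel_preimage.
- by apply: tP => //; exists (f x).
- by rewrite -preimage_bigcup uP preimage_setT.
Qed.

(** Subadditivity is Gibbs' inequality for the product of the two laws. *)
Lemma join_entropyD (I : finType) nu f (P : I -> set X) m n : continuous f ->
  invariant_measures f nu -> is_partition P ->
  partition_entropy nu (@join I f P (m + n)) <=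
  partition_entropy nu (@join I f P m) + partition_entropy nu (@join I f P n).
Proof.
move=> cf inv pP.
pose hl (s : {ffun 'I_(m + n) -> I}) : {ffun 'I_m -> I} :=
  [ffun i : 'I_m => s (lshift n i)].
pose hr (s : {ffun 'I_(m + n) -> I}) : {ffun 'I_n -> I} :=
  [ffun i : 'I_n => s (rshift m i)].
have pm := join_partition m cf pP; have pn := join_partition n cf pP.
have pmn := join_partition (m + n) cf pP.
have pn' := preimage_partition (iter_continuous (n := m) cf) pn.
have subl s : join f P s `<=` join f P (hl s).
  by move=> x sx i; rewrite ffunE; exact: (sx (lshift n i)).
have subr s : join f P s `<=` iter m f @^-1` join f P (hr s).
  by move=> x sx i; rewrite ffunE -iterD (addnC i m); exact: (sx (rshift m i)).
pose q s := mass nu (join f P (hl s)) * mass nu (join f P (hr s)).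
have q_p s : q s = 0 -> mass nu (join f P s) = 0.
  move=> /eqP qs; apply/eqP; rewrite eq_le mass_ge0 andbT.
  have [ml _ _] := pm; have [mr _ _] := pn; have [mr' _ _] := pn'.
  have [ms _ _] := pmn.
  move: qs; rewrite mulf_eq0 => /orP[]/eqP <-; first by apply: le_mass.
  rewrite -[leRHS](mass_preimage_iter m cf inv) //; apply: le_mass => //.
have sq1 : \sum_s q s <= 1.
  pose F (u : {ffun 'I_m -> I} * {ffun 'I_n -> I}) :=
    mass nu (join f P u.1) * mass nu (join f P u.2).
  have inj : injective (fun s => (hl s, hr s)).
    move=> s t [/ffunP hlE /ffunP hrE]; apply/ffunP => i.
    by case: (split_ordP i) => j ->; [move: (hlE j)|move: (hrE j)]; rewrite !ffunE.
  have F0 u : 0 <= F u by rewrite mulr_ge0 ?mass_ge0.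
  apply: le_trans (sum_inj_le inj F0) _; rewrite /F.
  rewrite -(pair_big xpredT xpredT (fun u v => mass nu (join f P u) * mass nu (join f P v)))/=.
  under eq_bigr do rewrite -mulr_sumr.
  by rewrite -mulr_suml !sum_mass_partition // mul1r.
have G := @gibbs R _ (fun s => mass nu (@join I f P (m + n) s)) q 1
   (fun s => mass_ge0 _ _) (fun s => mulr_ge0 (mass_ge0 _ _) (mass_ge0 _ _)) q_p
   (sum_mass_partition nu pmn) sq1.
rewrite partition_entropyE; apply: le_trans G _.
rewrite ln1 sub0r; have -> : \sum_s mass nu (@join I f P (m + n) s) * ln (q s) =
   \sum_s mass nu (join f P s) * ln (mass nu (join f P (hl s))) +
   \sum_s mass nu (join f P s) * ln (mass nu (join f P (hr s))).
  rewrite -big_split; apply: eq_bigr => s _ /=; rewrite -mulrDr.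
  have [s0|s0] := eqVneq (mass nu (join f P s)) 0; first by rewrite s0 !mul0r.
  congr (_ * _); have qs : q s != 0 by apply: contra_neq s0; exact: q_p.
  move: qs; rewrite mulf_eq0 negb_or => /andP[l0 r0].
  by rewrite lnM // posrE lt_neqAle eq_sym mass_ge0 ?l0 ?r0.
rewrite -(expect_coarse nu (fun u => ln (mass nu (join f P u))) pm pmn subl).
rewrite -(expect_coarse nu (fun u => ln (mass nu (join f P u))) pn' pmn subr).
rewrite !partition_entropyE.
under [X in - (_ + X) <= _]eq_bigr => s _.
  rewrite mass_preimage_iter //; last by case: pn.
  over.
by rewrite opprD.
Qed.

Lemma entropy_cvg (I : finType) nu f (P : I -> set X) : continuous f ->
  invariant_measures f nu -> is_partition P ->
  cvgn (fun n => n%:R^-1 * partition_entropy nu (@join I f P n)).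
Proof.
move=> cf inv pP; apply: (@fekete _ (fun n => partition_entropy nu (@join I f P n))).
  by move=> n; apply: partition_entropy_ge0; exact: join_partition.
by move=> m n; exact: join_entropyD.
Qed.

End Entropy.

(** * Regularity of Borel probability measures on a metric space *)

Section Regularity.
Context {R : realType} {X : pmetricType R}.
Implicit Types (nu : probability (borel X) R) (A B O C : set X).

Lemma mdist_lipschitz (x y z : X) : `|mdist x y - mdist x z| <= mdist y z.
Proof.
have := metric_triangle x y z; have := metric_triangle x z y.
by rewrite (metric_sym z y) ler_norml => ? ?; apply/andP; split; lra.
Qed.

Lemma mdist_continuous (x : X) : continuous (mdist x : X -> R).
Proof.
move=> y; apply/cvgrPdist_lt => /= e e0; near=> z.
apply: le_lt_trans (mdist_lipschitz x y z) _.
by near: z; have := nbhsx_ballx y _ e0; rewrite ballEmdist.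
Unshelve. all: by end_near. Qed.

Lemma closed_mdist_ge (x : X) r : closed [set y | r <= mdist x y].
Proof.
by move: (@mdist_continuous x) => /continuous_closedP /(_ _ (@closed_ge _ r)).
Qed.

Lemma closed_mdist_le (x : X) r : closed [set y | mdist x y <= r].
Proof.
by move: (@mdist_continuous x) => /continuous_closedP /(_ _ (@closed_le _ r)).
Qed.

Lemma open_mdist_lt (x : X) r : open [set y | mdist x y < r].
Proof.
by move: (@mdist_continuous x) => /continuousP /(_ _ (@open_lt _ r)).
Qed.

Lemma mass_exhaust nu (F : nat -> set X) e : (forall n, borel_set (F n)) ->
  nondecreasing_seq F -> 0 < e ->
  exists n, mass nu (\bigcup_n F n `\` F n) <= e.
Proof.
move=> mF ndF e0; have mU : borel_set (\bigcup_n F n) by exact: bigcupT_measurable.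
have := nondecreasing_cvg_mu (mu := nu) mF mU ndF.
rewrite (_ : nu \o F = EFin \o (fun n => mass nu (F n))); last first.
  by apply/funext => n; exact: massE.
rewrite [X in _ --> X](_ : _ = (mass nu (\bigcup_n F n))%:E); last exact: massE.
move=> /fine_cvgP[_] /cvgrPdist_le /(_ e e0)[n _] /(_ n (leqnn n)) /= ne.
exists n; rewrite massD //; last exact: bigcup_sup.
exact: le_trans (ler_norm _) ne.
Qed.

Definition regular_set nu A : Prop := forall e, 0 < e ->
  exists C O, [/\ closed C, open O, C `<=` A, A `<=` O & mass nu (O `\` C) <= e].

(** In a metric space, an open set is the increasing union of the closed sets of
    the points at distance at least [1 / n] from its complement. *)
Lemma open_regular nu O : open O -> regular_set nu O.
Proof.
move=> oO e e0; pose F n : set X := [set x | forall y, ~ O y -> n.+1%:R^-1 <= mdist y x].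
have cF n : closed (F n).
  rewrite (_ : F n = \bigcap_(y in ~` O) [set x | n.+1%:R^-1 <= mdist y x]).
    by apply: closed_bigI => y _; exact: closed_mdist_ge.
  by apply/seteqP; split.
have ndF : nondecreasing_seq F.
  move=> m n mn; apply/subsetPset => x Fx y Oy; apply: le_trans (Fx y Oy).
  by rewrite lef_pV2 ?posrE // ler_nat.
have UF : \bigcup_n F n = O.
  apply/seteqP; split => [x [n _ Fx]|x Ox].
    have [//|Oxn] := pselect (O x); have := Fx x Oxn.
    by rewrite mdistxx leNgt invr_gt0 ltr0n.
  have /nbhs_ballP[d /= d0 dO] : nbhs x O by apply: open_nbhs_nbhs; split.
  near \oo => n; exists n => // y Oy; rewrite metric_sym leNgt; apply/negP => xy.
  apply/Oy/dO; rewrite ballEmdist /=; apply: lt_trans xy _.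
  by near: n; exact: near_infty_natSinv_lt (PosNum d0).
have [n ne] := mass_exhaust nu (fun n => closed_borel (cF n)) ndF e0.
exists (F n), O; split => //; last by rewrite UF in ne.
by rewrite -UF; exact: bigcup_sup.
Unshelve. all: by end_near. Qed.

Lemma regular_setC nu A : regular_set nu A -> regular_set nu (~` A).
Proof.
move=> rA e e0; have [C [ O [cC oO CA AO le]]] := rA e e0.
exists (~` O), (~` C); split.
- exact: open_closedC.
- exact: closed_openC.
- exact: subsetC.
- exact: subsetC.
- by rewrite setDE setCK setIC -setDE.
Qed.

Lemma regular_bigcup nu (A : nat -> set X) :
  (forall n, regular_set nu (A n)) -> regular_set nu (\bigcup_n A n).
Proof.
move=> rA e e0.
have e2 : 0 < e / 2 by rewrite divr_gt0.
have /choice[CO COP] : forall n, exists CO : set X * set X,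
    [/\ closed CO.1, open CO.2, CO.1 `<=` A n, A n `<=` CO.2 &
        mass nu (CO.2 `\` CO.1) <= (e / 2) / (2 ^ n.+1)%:R].
  move=> n; have [|C [ O H]] := rA n ((e / 2) / (2 ^ n.+1)%:R); last by exists (C, O).
  by rewrite divr_gt0 // ltr0n expn_gt0.
pose C n := (CO n).1; pose O n := (CO n).2.
have cC n : closed (C n) by have [] := COP n.
have oO n : open (O n) by have [] := COP n.
have mC n := closed_borel (cC n); have mO n := open_borel (oO n).
have mUO : borel_set (\bigcup_n O n) by exact: bigcupT_measurable.
have mUC : borel_set (\bigcup_n C n) by exact: bigcupT_measurable.
pose F n := \big[setU/set0]_(i < n.+1) C i.
have cF n : closed (F n) by apply: closed_bigsetU => i _; exact: cC.
have UF : \bigcup_n F n = \bigcup_n C n.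
  by rewrite -(bigcup_bigsetU_bigcup C).
have ndF : nondecreasing_seq F by move=> a b ab; exact/subsetPset/subset_bigsetU.
have [n ne] := mass_exhaust nu (fun n => closed_borel (cF n)) ndF e2.
rewrite UF in ne.
have le1 : mass nu (\bigcup_n O n `\` \bigcup_n C n) <= e / 2.
  rewrite -lee_fin -massE; last exact: measurableD.
  have mD k : borel_set (O k `\` C k) by exact: measurableD.
  apply: (@le_trans _ _ (\sum_(k <oo) nu (O k `\` C k))%E).
    apply: measure_sigma_subadditive => //; first exact: measurableD.
    by move=> x [[k _ Okx] nC]; exists k => //; split => // Ckx; apply: nC; exists k.
  apply: le_trans (epsilon_trick0 xpredT (ltW e2)).
  apply: lee_nneseries => [k _ _|k _]; first exact: measure_ge0.
  by rewrite (massE nu (mD k)) lee_fin; have [] := COP k.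
exists (F n), (\bigcup_n O n); split => //.
- exact: bigcup_open.
- rewrite /F -bigcup_mkord => x [k _ Ckx]; exists k => //.
  by have [_ _ CA _ _] := COP k; exact: CA.
- move=> x [k _ Akx]; exists k => //.
  by have [_ _ _ AO _] := COP k; exact: AO.
- have mF := closed_borel (cF n).
  apply: le_trans (_ : mass nu ((\bigcup_n O n `\` \bigcup_n C n) `|`
                                (\bigcup_n C n `\` F n)) <= _).
    apply: le_mass; [exact: measurableD|by apply: measurableU; exact: measurableD|].
    by move=> x [Ox Fx]; have [Cx|Cx] := pselect ((\bigcup_n C n) x); [right|left].
  rewrite massU; [|exact: measurableD|exact: measurableD|].
    by rewrite [leRHS]splitr lerD.
  by apply/seteqP; split => // x [[_ nC] [Cx _]].
Qed.

(** The regular sets form a sigma-algebra, and it contains the open sets. *)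
Lemma borel_regular nu A : borel_set A -> regular_set nu A.
Proof.
pose S : set (set X) := [set B | regular_set nu B].
suff : sigma_algebra setT S.
  by move=> sS; move: A; apply: smallest_sub => // B; exact: open_regular.
split => [|B|B].
- exact: open_regular open0.
- by rewrite setTD; exact: regular_setC.
- exact: regular_bigcup.
Qed.

(** Outer regularity extends the inequality to all Borel sets, and taking
    complements reverses it. *)
Lemma probability_le_open nu1 nu2 :
  (forall O, open O -> mass nu1 O <= mass nu2 O) ->
  forall A, borel_set A -> mass nu1 A = mass nu2 A.
Proof.
move=> le12; have le A : borel_set A -> mass nu1 A <= mass nu2 A.
  move=> mA; apply/ler_addgt0Pr => e e0.
  have [C [ O [cC oO CA AO ne]]] := borel_regular nu2 mA e0.
  have mC := closed_borel cC; have mO := open_borel oO.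
  apply: le_trans (le_mass nu1 mA mO AO) _; apply: le_trans (le12 O oO) _.
  apply: le_trans (mass_le_D nu2 mC mO) _.
  by rewrite lerD // le_mass.
move=> A mA; apply/eqP; rewrite eq_le le //=.
by have := le _ (measurableC mA); rewrite !mass_setC // lerD2l lerN2.
Qed.

End Regularity.

(** * Uniformity on compact metric spaces, and means of bounded functions *)

Section Uniform.
Context {R : realType} {X : pmetricType R}.

(** Compactness turns a local choice of radius into a uniform one. *)
Lemma compact_uniform (P : R -> X -> Prop) : compact [set: X] ->
  (forall d d' x, d' <= d -> P d x -> P d' x) ->
  (forall x0, exists2 d, 0 < d & forall x, mdist x0 x < d -> P d x) ->
  exists2 d, 0 < d & forall x, P d x.
Proof.
move=> /compact_near_coveringP cX Pmono Ploc.
have := cX R (0^'+ : set_system R) P (at_right_proper_filter _).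
case=> [x0 _|e /= e0 eP].
  have [d d0 dP] := Ploc x0.
  exists ([set x | mdist x0 x < d], [set e | e <= d]) => /=.
    split; last exact: nbhs_right_le.
    by have := nbhsx_ballx x0 _ d0; rewrite ballEmdist.
  by move=> [x e] /= [xd ed]; apply: Pmono ed _; exact: dP.
exists (e / 2); first by rewrite divr_gt0.
move=> x; apply: eP => //=; last by rewrite divr_gt0.
by rewrite sub0r normrN gtr0_norm ?divr_gt0 // ltr_pdivrMr // ltr_pMr // ltr1n.
Qed.

Lemma compact_modulus (g : X -> R) eta : compact [set: X] -> continuous g ->
  0 < eta -> exists2 d, 0 < d &
    forall x y, mdist x y <= d -> `|g x - g y| <= eta.
Proof.
move=> cX cg eta0.
have [||d d0 dP] := @compact_uniform
  (fun d x => forall y, mdist x y <= d -> `|g x - g y| <= eta) cX; last by exists d.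
  by move=> d d' x dd' H y xy; apply: H; exact: le_trans dd'.
move=> x0; have /cvgrPdist_lt /(_ (eta / 2)) := cg x0.
rewrite divr_gt0 // => /(_ isT) /nbhs_ballP[d /= d0 dg].
exists (d / 2) => [|x x0x y xy]; first by rewrite divr_gt0.
have bx : ball x0 d x by rewrite ballEmdist /=; lra.
have yd : ball x0 d y.
  by rewrite ballEmdist /=; apply: le_lt_trans (metric_triangle x0 x y) _; lra.
have := ltW (dg _ bx); have := ltW (dg _ yd); rewrite /= => H1 H2.
rewrite (_ : g x - g y = (g x0 - g y) - (g x0 - g x)); last by ring.
by apply: le_trans (ler_normB _ _) _; lra.
Qed.

(** Near [x0], only the sets that contain [x0] are met, and there is at most one. *)
Lemma closed_family_gap (I : finType) (B : I -> set X) : compact [set: X] ->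
  (forall i, closed (B i)) -> trivIset [set: I] B ->
  exists2 d, 0 < d & forall i j x y, B i x -> B j y -> mdist x y <= d -> i = j.
Proof.
move=> cX cB tB.
have [||d d0 dP] := @compact_uniform
  (fun d x => forall i j y, B i x -> B j y -> mdist x y <= d -> i = j) cX.
- by move=> d d' x dd' H i j y Bi Bj xy; apply: (H i j y) => //; exact: le_trans dd'.
- move=> x0.
  have [d d0 dB] : exists2 d, 0 < d & forall i, ~ B i x0 ->
      forall y, mdist x0 y < d -> ~ B i y.
    have : \forall d \near 0^'+, forall i, ~ B i x0 ->
      forall y, mdist x0 y < d -> ~ B i y.
      apply: filter_forall => i; have [Bx|Bx] := pselect (B i x0).
        by near=> d => nB; case: nB.
      have /nbhs_ballP[e /= e0 eB] : nbhs x0 (~` B i).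
        by apply: open_nbhs_nbhs; split => //; exact: closed_openC.
      near=> d => _ y xy; apply: eB; rewrite ballEmdist /=.
      by apply: lt_le_trans xy _; near: d; exact: nbhs_right_le.
    case=> e /= e0 eB; exists (e / 2); first by rewrite divr_gt0.
    apply: eB => /=; last by rewrite divr_gt0.
    by rewrite sub0r normrN gtr0_norm ?divr_gt0 // ltr_pdivrMr // ltr_pMr // ltr1n.
  exists (d / 2); first by rewrite divr_gt0.
  move=> x x0x i j y Bx By xy.
  have Bi : B i x0 by apply: contrapT => /dB/(_ x); apply => //; lra.
  have Bj : B j x0.
    apply: contrapT => /dB/(_ y); apply => //.
    by apply: le_lt_trans (metric_triangle x0 x y) _; lra.
  by apply: tB => //; exists x0.
- by exists d => // i j x y; exact: dP.
Unshelve. all: by end_near. Qed.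

Lemma compact_bounded_fun (g : X -> R) : compact [set: X] -> continuous g ->
  exists2 M, 0 < M & forall x, `|g x| <= M.
Proof.
move=> cX cg; have : bounded_set (g @` setT).
  by apply/compact_bounded/continuous_compact => //; exact: continuous_subspaceT.
case=> M [_ H]; exists (Num.max 1 (M + 1)).
  by rewrite lt_max ltr01.
by move=> x; apply: (H (Num.max 1 (M + 1))); [rewrite lt_max ltrDl ltr01 orbT|exists x].
Qed.

Lemma compact_pos_lbound (g : X -> R) : compact [set: X] -> continuous g ->
  (forall x, 0 < g x) -> exists2 m, 0 < m & forall x, m <= g x.
Proof.
move=> cX cg g0; apply: (@compact_uniform (fun d x => d <= g x) cX).
  by move=> d d' x; exact: le_trans.
move=> x0; have g20 : 0 < g x0 / 2 by rewrite divr_gt0.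
have /cvgrPdist_lt /(_ (g x0 / 2) g20) /nbhs_ballP[d /= d0 dg] := cg x0.
exists (Num.min d (g x0 / 2)); first by rewrite lt_min d0.
move=> x; rewrite lt_min ge_min => /andP[xd _]; apply/orP; right.
have : ball x0 d x by rewrite ballEmdist.
move=> /dg /=; rewrite ltr_norml => /andP[_]; lra.
Qed.

Lemma bowen_dist_leP f n (x y : X) eps : 0 <= eps ->
  bowen_dist f n x y <= eps <->
  forall i, (i < n)%N -> mdist (iter i f x) (iter i f y) <= eps.
Proof.
move=> eps0; split => [/bigmax_leP[_ H] i i_n|H]; first exact: (H (Ordinal i_n)).
by apply/bigmax_leP; split => // i _; exact: H.
Qed.

Lemma birkhoff_dist_le f (g : X -> R) n x y eps d : 0 <= eps ->
  (forall x y, mdist x y <= eps -> `|g x - g y| <= d) ->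
  bowen_dist f n x y <= eps ->
  `|birkhoff_sum f g n x - birkhoff_sum f g n y| <= n%:R * d.
Proof.
move=> eps0 H /(bowen_dist_leP _ _ _ _ eps0) xy; rewrite -sumrB.
apply: le_trans (ler_norm_sum _ _ _) _.
rewrite -[X in X%:R * d](card_ord n) mulr_natl -sumr_const.
by apply: ler_sum => i _; apply: H; exact: xy.
Qed.

End Uniform.

Section Mean.
Context {R : realType} {X : pmetricType R}.
Implicit Types (nu : probability (borel X) R) (f : X -> X) (g h : X -> R).

Definition mean nu g : R := fine (\int[nu]_x (g x)%:E).

Definition bounded_borel g : Prop :=
  measurable_fun [set: borel X] (g : borel X -> R) /\ exists M, forall x, `|g x| <= M.

Lemma continuous_bounded_borel g : compact [set: X] -> continuous g ->
  bounded_borel g.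
Proof.
move=> cX cg; split; first exact: continuous_borel_fun.
by have [M _ gM] := compact_bounded_fun cX cg; exists M.
Qed.

Lemma bounded_borel_integrable nu g : bounded_borel g ->
  nu.-integrable [set: borel X] (EFin \o g).
Proof.
move=> [mg [M gM]]; apply: measurable_bounded_integrable => //.
  by apply: le_lt_trans (probability_le1 nu measurableT) _; rewrite ltry.
exists M; split; first exact: num_real.
by move=> N MN x _; apply: le_trans (gM x) (ltW MN).
Qed.

Lemma meanE nu g : bounded_borel g -> (\int[nu]_x (g x)%:E)%E = (mean nu g)%:E.
Proof.
move=> bg; rewrite /mean fineK //; apply: integrable_fin_num => //.
exact: bounded_borel_integrable.
Qed.

Lemma le_mean nu g h : bounded_borel g -> bounded_borel h ->
  (forall x, g x <= h x) -> mean nu g <= mean nu h.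
Proof.
move=> bg bh gh; apply: le_Rintegral => //; exact: bounded_borel_integrable.
Qed.

Lemma mean_cst nu (a : R) : mean nu (fun=> a) = a.
Proof.
by rewrite /mean -[LHS]/(Rintegral nu setT (fun=> a)) Rintegral_cst // [fine _]massT mulr1.
Qed.

Lemma bounded_borelD g h : bounded_borel g -> bounded_borel h ->
  bounded_borel (fun x => g x + h x).
Proof.
move=> [mg [M gM]] [mh [N hN]]; split; first exact: measurable_funD.
by exists (M + N) => x; apply: le_trans (ler_normD _ _) _; exact: lerD.
Qed.

Lemma bounded_borelZ g (a : R) : bounded_borel g -> bounded_borel (fun x => a * g x).
Proof.
move=> [mg [M gM]]; split; first exact: measurable_funM.
by exists (`|a| * M) => x; rewrite normrM ler_wpM2l.
Qed.

Lemma bounded_borel_cst (a : R) : bounded_borel (fun=> a).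
Proof. by split; [exact: measurable_cst|exists `|a|]. Qed.

Lemma bounded_borel_comp f g : continuous f -> bounded_borel g ->
  bounded_borel (fun x => g (f x)).
Proof.
move=> cf [mg [M gM]]; split; last by exists M => x.
move=> _ A mA; have := mg measurableT A mA; rewrite !setTI => mgA.
exact: (continuous_borel_preimage cf mgA).
Qed.

Lemma bounded_borel_indic A : borel_set A -> bounded_borel (\1_A : X -> R).
Proof.
move=> mA; split; first exact: measurable_indic.
by exists 1 => x; rewrite indicE; case: (_ \in _); rewrite ?normr1 ?normr0.
Qed.

Lemma meanD nu g h : bounded_borel g -> bounded_borel h ->
  mean nu (fun x => g x + h x) = mean nu g + mean nu h.
Proof.
by move=> bg bh; apply: RintegralD => //; exact: bounded_borel_integrable.
Qed.

Lemma meanZ nu g (a : R) : bounded_borel g -> mean nu (fun x => a * g x) = a * mean nu g.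
Proof.
by move=> bg; apply: RintegralZl => //; exact: bounded_borel_integrable.
Qed.

Lemma mean_indic nu A : borel_set A -> mean nu (\1_A : X -> R) = mass nu A.
Proof. by move=> mA; rewrite /mean integral_indic // setIT. Qed.

Lemma bounded_borel_sum (I : Type) (s : seq I) (F : I -> X -> R) :
  (forall i, bounded_borel (F i)) -> bounded_borel (fun x => \sum_(i <- s) F i x).
Proof.
move=> bF; elim: s => [|i s IH].
  rewrite (_ : (fun=> _) = fun=> 0); first exact: bounded_borel_cst.
  by apply/funext => x; rewrite big_nil.
under eq_fun do rewrite big_cons; exact: bounded_borelD.
Qed.

Lemma mean_sum nu (I : Type) (s : seq I) (F : I -> X -> R) :
  (forall i, bounded_borel (F i)) ->
  mean nu (fun x => \sum_(i <- s) F i x) = \sum_(i <- s) mean nu (F i).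
Proof.
move=> bF; elim: s => [|i s IH].
  by under eq_fun do rewrite big_nil; rewrite mean_cst big_nil.
under eq_fun do rewrite big_cons; rewrite meanD ?big_cons ?IH //.
exact: bounded_borel_sum.
Qed.

(** Comparison with the step function [a]. *)
Lemma mean_le_partition (I : finType) nu (P : I -> set X) g (a : I -> R) :
  is_partition P -> bounded_borel g -> (forall i x, P i x -> g x <= a i) ->
  mean nu g <= \sum_i mass nu (P i) * a i.
Proof.
move=> pP bg ga; have [mP tP uP] := pP; have [c cP] := partition_index pP.
have bF i : bounded_borel (fun x => a i * (\1_(P i) : X -> R) x).
  by apply: bounded_borelZ; exact: bounded_borel_indic.
have -> : \sum_i mass nu (P i) * a i =
    mean nu (fun x => \sum_i a i * (\1_(P i) : X -> R) x).
  rewrite mean_sum //; apply: eq_bigr => i _.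
  by rewrite meanZ ?mean_indic 1?mulrC //; exact: bounded_borel_indic.
apply: le_mean => //; first exact: bounded_borel_sum.
move=> x; rewrite (bigD1 (c x)) //= big1 => [|i ixc].
  have Pcx : P (c x) x by apply/cP.
  by rewrite addr0 indicE mem_set // mulr1 ga.
rewrite indicE memNset ?mulr0 // => /cP ic; by rewrite ic eqxx in ixc.
Qed.

Lemma mean_comp_invariant nu f g : continuous f -> invariant_measures f nu ->
  bounded_borel g -> mean nu (fun x => g (f x)) = mean nu g.
Proof.
move=> cf inv bg; have [mg _] := bg.
have mf : measurable_fun [set: borel X] (f : borel X -> borel X).
  by move=> _ A mA; rewrite setTI; exact: continuous_borel_preimage.
have := @integral_pushforward _ _ (borel X) (borel X) R f mf nu setT (EFin \o g).
move=> H; rewrite /mean; congr fine; symmetry; apply: etrans; last first.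
  apply: H => //; first exact/measurable_EFinP.
  by rewrite preimage_setT; apply: bounded_borel_integrable; exact: bounded_borel_comp.
by apply: eq_measure_integral => A mA _; exact/esym/inv.
Qed.

Lemma bounded_borel_iter f g n : continuous f -> bounded_borel g ->
  bounded_borel (fun x => g (iter n f x)).
Proof. by move=> cf; apply: bounded_borel_comp; exact: iter_continuous. Qed.

Lemma bounded_borel_birkhoff f g n : continuous f -> bounded_borel g ->
  bounded_borel (birkhoff_sum f g n).
Proof. by move=> cf bg; apply: bounded_borel_sum => i; exact: bounded_borel_iter. Qed.

Lemma mean_birkhoff nu f g n : continuous f -> invariant_measures f nu ->
  bounded_borel g -> mean nu (birkhoff_sum f g n) = n%:R * mean nu g.
Proof.
move=> cf inv bg; rewrite /birkhoff_sum mean_sum; last first.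
  by move=> i; exact: bounded_borel_iter.
rewrite mulr_natl -[X in _ *+ X](card_ord n) -sumr_const; apply: eq_bigr => i _.
elim: (nat_of_ord i) => [//|k IH]; rewrite -[RHS]IH.
have bk := bounded_borel_iter k cf bg.
rewrite -[RHS](mean_comp_invariant cf inv bk).
by congr mean; apply/funext => x; rewrite iterSr.
Qed.

End Mean.

(** * Entropy is bounded by the growth of exponential sums over spanning sets *)

Section EntropyUpper.
Context {R : realType} {X : pmetricType R} (f : X -> X).
Implicit Types (nu : probability (borel X) R) (g : X -> R).

(** The cell [P i] is cut into its core [B i], with index [(i, true)], and the rest,
    with index [(i, false)]. *)
Definition core_cells (I : finType) (P B : I -> set X) (j : I * bool) : set X :=
  if j.2 then B j.1 else P j.1 `\` B j.1.

Lemma core_cells_sub (I : finType) (P B : I -> set X) (j : I * bool) :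
  (forall i, B i `<=` P i) -> core_cells P B j `<=` P j.1.
Proof. by move=> BP; rewrite /core_cells; case: j.2; [exact: BP|exact: subDsetl]. Qed.

Lemma core_cells_partition (I : finType) (P B : I -> set X) : is_partition P ->
  (forall i, closed (B i)) -> (forall i, B i `<=` P i) ->
  is_partition (core_cells P B).
Proof.
move=> [mP tP uP] cB BP; have mB i := closed_borel (cB i); split.
- by move=> [i []]; rewrite /core_cells //=; exact: measurableD.
- move=> [i a] [j b] _ _ [x [xi xj]].
  have ij : i = j.
    apply: tP => //; exists x.
    by split; [exact: (core_cells_sub BP xi)|exact: (core_cells_sub BP xj)].
  subst j; congr (_, _); move: xi xj; rewrite /core_cells /=.
  by case: a; case: b => //; [move=> Bx [_]|move=> [_ nB] Bx; move: nB].
- apply/seteqP; split => // x _; have : [set: X] x by [].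
  rewrite -uP => -[i _ Pi]; have [Bi|nBi] := pselect (B i x).
    by exists (i, true).
  by exists (i, false).
Qed.

(** Cells are not closed, so the supremum over a cell is only approached; the
    error [1] is lost when dividing by [n]. *)
Lemma near_sup (P : set X) g : (exists M, forall x, `|g x| <= M) -> P !=set0 ->
  exists2 x, P x & forall y, P y -> g y <= g x + 1.
Proof.
move=> [M gM] [x0 Px0]; have Sup : has_sup [set g x | x in P].
  split; first by exists (g x0), x0.
  by exists M => _ [x _ <-]; apply: le_trans (ler_norm _) (gM x).
have [_ [x Px <-] gx] := sup_adherent ltr01 Sup.
exists x => // y Py; have : g y <= sup [set g x | x in P].
  by apply: ub_le_sup; [exact: Sup.2|exists y].
by lra.
Qed.

(** The weight of the letters that are compatible at one time with an orbit
    shadowed by [z]: at most one core is close to [z], and every rest has weight at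
    most [kappa]. *)
Lemma sum_allowed_le (I : finType) (B : I -> set X) (kappa eps d : R) (z : X)
    (v : I * bool -> R) :
  0 <= kappa -> eps + eps <= d ->
  (forall i j x y, B i x -> B j y -> mdist x y <= d -> i = j) ->
  (forall i, v (i, false) <= kappa) -> (forall i, v (i, true) <= 1) ->
  (forall i, (exists2 x, B i x & mdist x z <= eps) \/ v (i, true) <= 0) ->
  \sum_j v j <= 1 + #|I|%:R * kappa.
Proof.
move=> k0 epsd gap vF vT vTz.
rewrite (eq_bigr (fun j => v (j.1, j.2))); last by case.
rewrite -(pair_big xpredT xpredT (fun i b => v (i, b))) /= exchange_big /=.
rewrite big_bool /=; apply: lerD; last first.
  rewrite -[X in X * _]/(#|I|%:R) mulr_natl -sumr_const.
  by apply: ler_sum => i _; exact: vF.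
have [[i [x Bx xz]]|H] := pselect (exists i, exists2 x, B i x & mdist x z <= eps).
  rewrite (bigD1 i) //= -[leRHS]addr0; apply: lerD; first exact: vT.
  apply: sumr_le0 => j ji; have [[y By yz]|//] := vTz j.
  case/eqP: ji; apply: (gap j i y x) => //.
  apply: le_trans (metric_triangle y z x) _; apply: le_trans epsd.
  by rewrite lerD // metric_sym.
apply: (@le_trans _ _ 0); last exact: ler01.
by apply: sumr_le0 => j _; have [Hj|//] := vTz j; case: H; exists j.
Qed.

(** Gibbs' inequality with weight [kappa] for each visit outside the cores: the
    cores visited by an orbit are determined by any orbit that shadows it, so
    the spanning set controls the total weight, while the visits outside the
    cores are rare. *)
Lemma spanning_entropy_bound (I : finType) nu g (P B : I -> set X)
    (kappa eps d eta Z : R) (F : set X) n :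
  compact [set: X] -> continuous f -> continuous g -> invariant_measures f nu ->
  is_partition P -> (forall i, closed (B i)) -> (forall i, B i `<=` P i) ->
  0 < kappa -> 0 <= eps -> eps + eps <= d ->
  (forall i j x y, B i x -> B j y -> mdist x y <= d -> i = j) ->
  (forall x y, mdist x y <= eps -> `|g x - g y| <= eta) ->
  spanning f n eps setT F ->
  (forall E : seq X, uniq E -> (forall x, x \in E -> F x) ->
    \sum_(x <- E) expR (birkhoff_sum f g n x) <= Z) ->
  partition_entropy nu (@join _ _ I f P n) + n%:R * mean nu g <=
  ln Z + 1 + n%:R * (eta + #|I|%:R * kappa -
    ln kappa * \sum_i mass nu (P i `\` B i)).
Proof.
move=> cX cf cg inv pP cB BP k0 eps0 epsd gap modg spF sumF.
set C := core_cells P B.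
have pC : is_partition C := core_cells_partition pP cB BP.
pose Q := @join _ _ (I * bool)%type f C n.
have pQ : is_partition Q := join_partition n cf pC.
have pPn : is_partition (@join _ _ I f P n) := join_partition n cf pP.
have bg : bounded_borel g by exact: continuous_bounded_borel.
have bS := bounded_borel_birkhoff n cf bg.
set S := birkhoff_sum f g n in bS *.
pose h (c : {ffun 'I_n -> I * bool}) : {ffun 'I_n -> I} := [ffun i => (c i).1].
have refine : partition_entropy nu (@join _ _ I f P n) <= partition_entropy nu Q.
  apply: (partition_entropy_refine nu (h := h) pPn pQ) => c x Qx i.
  by rewrite ffunE; apply: (core_cells_sub BP (Qx i)).
pose ne c := `[< Q c !=set0 >].
have /choice[xc xcP] : forall c, exists x, Q c !=set0 ->
    Q c x /\ forall y, Q c y -> S y <= S x + 1.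
  move=> c; have [Q0|Q0] := pselect (Q c !=set0); last by exists point.
  by have [x Qx xS] := near_sup bS.2 Q0; exists x.
have /choice[yc ycP] : forall c, exists y, F y /\ bowen_dist f n y (xc c) <= eps.
  by move=> c; have [y Fy xy] := spF (xc c) Logic.I; exists y; split => //.
have b1 x y : bowen_dist f n y x <= eps -> S x <= S y + n%:R * eta.
  by move=> /(birkhoff_dist_le eps0 modg); rewrite -/S ler_norml => /andP[+ _]; lra.
pose w (b : bool) : R := if b then 1 else kappa.
have w0 b : 0 < w b by rewrite /w; case: b.
pose W (c : {ffun 'I_n -> I * bool}) := \prod_(i < n) w (c i).2.
have W0 c : 0 < W c by exact: prodr_gt0.
pose q c := if ne c then expR (S (xc c) + 1) * W c else 0.
have q0 c : 0 <= q c.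
  by rewrite /q; case: ifP => // _; rewrite mulr_ge0 ?expR_ge0 // ltW.
have emptyQ c : ~~ ne c -> mass nu (Q c) = 0.
  by move=> /asboolPn /set0P/negP/negPn/eqP ->; exact: mass0.
have qp c : q c = 0 -> mass nu (Q c) = 0.
  rewrite /q; case: ifPn => [_ /eqP|/emptyQ //].
  by rewrite mulf_eq0 !gt_eqF ?expR_gt0.
pose K := (expR (n%:R * eta + 1) * Z) * (1 + #|I|%:R * kappa) ^+ n.
have Ik0 : 0 < 1 + #|I|%:R * kappa by rewrite ltr_wpDr // mulr_ge0 // ltW.
have sumq : \sum_c q c <= K.
  (* [V y c] is the weight of [c] if the orbit of [y] can shadow it, and else 0 *)
  pose v (y : X) (i : 'I_n) (j : I * bool) : R :=
    if j.2 then (if `[< exists2 x, B j.1 x & mdist x (iter i f y) <= eps >] then 1 else 0)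
    else kappa.
  have v0 y i j : 0 <= v y i j.
    by rewrite /v; case: j.2; [case: ifP|rewrite ltW].
  pose V y (c : {ffun 'I_n -> I * bool}) := \prod_(i < n) v y i (c i).
  have sumV y : \sum_c V y c <= (1 + #|I|%:R * kappa) ^+ n.
    rewrite -bigA_distr_bigA /= -[X in _ ^+ X](card_ord n) -prodr_const.
    apply: ler_prod => i _; rewrite sumr_ge0 //=.
    apply: (@sum_allowed_le _ B _ _ _ (iter i f y) (v y i) (ltW k0) epsd gap) => k.
    + by rewrite /v.
    + by rewrite /v /=; case: ifP.
    + by rewrite /v /=; case: asboolP; [left|right].
  have WV c : ne c -> W c = V (yc c) c.
    move=> /asboolP/xcP[Qx _]; apply: eq_bigr => i _; rewrite /w /v.
    case E : (c i).2 => //; rewrite (asboolT (P := exists2 _, _ & _)) //.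
    exists (iter i f (xc c)).
      by move: (Qx i); rewrite /C /core_cells E.
    by rewrite metric_sym; have [_ /(bowen_dist_leP _ _ _ _ eps0)] := ycP c; exact.
  pose E := undup [seq yc c | c <- index_enum _].
  have yE c : yc c \in E by rewrite mem_undup map_f // mem_index_enum.
  have EF y : y \in E -> F y.
    by rewrite mem_undup => /mapP[c _ ->]; have [] := ycP c.
  apply: (@le_trans _ _ (\sum_c \sum_(y <- E) expR (S y + n%:R * eta + 1) * V y c)).
    apply: ler_sum => c _; rewrite (bigD1_seq (yc c)) ?undup_uniq //=.
    have V0 y : 0 <= V y c by exact: prodr_ge0.
    have rest : 0 <= \sum_(y <- E | y != yc c) expR (S y + n%:R * eta + 1) * V y c.
      by apply: sumr_ge0 => y _; rewrite mulr_ge0 // expR_ge0.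
    rewrite -[leLHS]addr0; apply: lerD => //; rewrite /q; case: ifPn => [nec|_]; last first.
      by rewrite mulr_ge0 // expR_ge0.
    rewrite WV // ler_wpM2r // ler_expR lerD2r; apply: b1.
    by have [] := ycP c.
  rewrite exchange_big /=.
  apply: (@le_trans _ _ (\sum_(y <- E) expR (n%:R * eta + 1) * expR (S y) *
                           (1 + #|I|%:R * kappa) ^+ n)).
    apply: ler_sum => y _; rewrite -mulr_sumr -expRD.
    rewrite (_ : _ + _ + 1 = n%:R * eta + 1 + S y); last by ring.
    by rewrite ler_wpM2l // expR_ge0.
  rewrite -mulr_suml -mulr_sumr /K ler_wpM2r ?exprn_ge0 ?(ltW Ik0) //.
  by rewrite ler_wpM2l ?expR_ge0 // sumF // undup_uniq.
have Z0 : 0 < Z.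
  have [y Fy _] := spF point Logic.I; apply: lt_le_trans (sumF [:: y] isT _).
    by rewrite big_seq1 expR_gt0.
  by move=> x; rewrite inE => /eqP ->.
have G := gibbs (fun c => mass_ge0 nu (Q c)) q0 qp (sum_mass_partition nu pQ) sumq.
have lnK : ln K <= ln Z + 1 + n%:R * (eta + #|I|%:R * kappa).
  rewrite /K lnM ?posrE ?mulr_gt0 ?expR_gt0 ?exprn_gt0 // lnM ?posrE ?expR_gt0 //.
  rewrite expRK lnXn // -mulr_natl.
  have : ln (1 + #|I|%:R * kappa) <= #|I|%:R * kappa.
    by apply: le_ln1Dx; apply: lt_le_trans (ltrN10 _) _; rewrite mulr_ge0 // ltW.
  by move=> /(ler_wpM2l (ler0n R n)); rewrite mulrDr; lra.
have lnqE : \sum_c mass nu (Q c) * ln (q c) =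
    \sum_c mass nu (Q c) * (S (xc c) + 1) + \sum_c mass nu (Q c) * ln (W c).
  rewrite -big_split; apply: eq_bigr => c _ /=; rewrite -mulrDr /q.
  case: ifPn => [_|/emptyQ ->]; last by rewrite !mul0r.
  by rewrite lnM ?posrE ?expR_gt0 // expRK.
have meanS : n%:R * mean nu g <= \sum_c mass nu (Q c) * (S (xc c) + 1).
  rewrite -(mean_birkhoff n cf inv bg); apply: mean_le_partition => // c x Qx.
  by have [_ ->] := xcP c (ex_intro _ x Qx).
have lnW : \sum_c mass nu (Q c) * ln (W c) =
    n%:R * (ln kappa * \sum_i mass nu (P i `\` B i)).
  have lnWE c : ln (W c) = \sum_(i < n) ln (w (c i).2).
    rewrite /W.
    suff [] : 0 < \prod_(i < n) w (c i).2 /\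
        ln (\prod_(i < n) w (c i).2) = \sum_(i < n) ln (w (c i).2) by [].
    elim/big_rec2: _ => [|i y z _ [z0 zE]]; first by rewrite ltr01 ln1.
    by split; [exact: mulr_gt0|rewrite lnM ?posrE // zE].
  have expi (i : 'I_n) : \sum_c mass nu (Q c) * ln (w (c i).2) =
      ln kappa * \sum_k mass nu (P k `\` B k).
    have pCi := preimage_partition (iter_continuous (n := i) cf) pC.
    rewrite -(expect_coarse nu (fun j => ln (w j.2)) pCi pQ 
      (h := fun c : {ffun 'I_n -> I * bool} => c i)); last first.
      by move=> c x; exact.
    rewrite (eq_bigr (fun j => mass nu (C (j.1, j.2)) * ln (w j.2))); last first.
      by move=> [k b] _; rewrite mass_preimage_iter //; case: pC.
    rewrite -(pair_big xpredT xpredT (fun k b => mass nu (C (k, b)) * ln (w b))) /=.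
    rewrite mulr_sumr; apply: eq_bigr => k _; rewrite big_bool /= ln1 mulr0 add0r.
    by rewrite mulrC.
  under eq_bigr do rewrite lnWE mulr_sumr.
  rewrite exchange_big /= (eq_bigr _ (fun i _ => expi i)).
  by rewrite sumr_const card_ord mulr_natl.
move: G lnK meanS refine; rewrite lnqE lnW !partition_entropyE.
rewrite mulrBr; set a := n%:R * (ln kappa * _); lra.
Qed.

(** Inner regularity, shared between the cells. *)
Lemma closed_cores (I : finType) nu (P : I -> set X) e : is_partition P -> 0 < e ->
  exists B : I -> set X, [/\ forall i, closed (B i), forall i, B i `<=` P i &
    \sum_i mass nu (P i `\` B i) <= e].
Proof.
move=> [mP _ _] e0; pose e' := e / (#|I|%:R + 1).
have I0 : 0 < #|I|%:R + 1 :> R by rewrite ltr_wpDl.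
have e'0 : 0 < e' by rewrite divr_gt0.
have /choice[B BP] : forall i, exists B, [/\ closed B, B `<=` P i &
    mass nu (P i `\` B) <= e'].
  move=> i; have [C [ O [cC oO CP PO le]]] := borel_regular nu (mP i) e'0.
  have mC := closed_borel cC; have mO := open_borel oO.
  exists C; split => //; apply: le_trans le; apply: le_mass.
  - exact: measurableD.
  - exact: measurableD.
  - exact: setSD.
exists B; split => [i|i|]; [by have [] := BP i|by have [] := BP i|].
apply: (@le_trans _ _ (\sum_(i : I) e')); first by apply: ler_sum => i _; have [] := BP i.
rewrite sumr_const -[X in X <= _]mulr_natl mulrC -mulrA mulrC ler_piMl // ?ltW //.
by rewrite ltr_pdivrMl // mulr1 ltrDl.
Qed.

(** The order of the choices is [kappa], then the cores, then the scale [eps]: the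
    cost [- ln kappa] of a visit outside the cores is known when the cores are taken
    large enough to compensate it. *)
Lemma entropy_le_growth (I : finType) nu g (P : I -> set X) :
  compact [set: X] -> continuous f -> continuous g -> invariant_measures f nu ->
  is_partition P ->
  (forall eps eta, 0 < eps -> 0 < eta -> exists n0, forall n, (n0 <= n)%N ->
    exists2 F, spanning f n eps setT F & forall E : seq X, uniq E ->
      (forall x, x \in E -> F x) ->
      \sum_(x <- E) expR (birkhoff_sum f g n x) <= expR (n%:R * eta)) ->
  limn (fun n => n%:R^-1 * partition_entropy nu (@join _ _ I f P n)) + mean nu g <= 0.
Proof.
move=> cX cf cg inv pP growth; apply/ler_addgt0Pr => e e0; rewrite add0r.
pose eta := e / 5; have eta0 : 0 < eta by rewrite divr_gt0.
have I0 : 0 < #|I|%:R + 1 :> R by rewrite ltr_wpDl.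
pose kappa := Num.min 1 (eta / (#|I|%:R + 1)).
have k0 : 0 < kappa by rewrite lt_min ltr01 divr_gt0.
have Ik : #|I|%:R * kappa <= eta.
  apply: (@le_trans _ _ (#|I|%:R * (eta / (#|I|%:R + 1)))).
    by rewrite ler_wpM2l // ge_min lexx orbT.
  by rewrite mulrCA ger_pMr // ler_pdivrMr // mul1r lerDl.
have lnk : 0 <= - ln kappa by rewrite oppr_ge0 ln_le0 // ge_min lexx.
have lnk1 : 0 < 1 - ln kappa by rewrite ltr_wpDr.
have [B [cB BP Be]] := closed_cores nu pP (divr_gt0 eta0 lnk1).
have Bk : - (ln kappa * \sum_i mass nu (P i `\` B i)) <= eta.
  rewrite -mulNr; apply: le_trans (ler_wpM2l lnk Be) _.
  by rewrite mulrCA ger_pMr // ler_pdivrMr // mul1r lerDr.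
have tB : trivIset [set: I] B.
  move: pP => [_ tP _] i j _ _ [x [Bi Bj]]; apply: tP => //.
  by exists x; split; exact: BP.
have [d d0 gap] := closed_family_gap cX cB tB.
have [d' d'0 modg] := compact_modulus cX cg eta0.
pose eps := Num.min (d / 2) d'.
have eps0 : 0 < eps by rewrite lt_min d'0 divr_gt0.
have epsd : eps + eps <= d by rewrite [leRHS]splitr lerD // ge_min lexx.
have modg' x y : mdist x y <= eps -> `|g x - g y| <= eta.
  by move=> xy; apply: modg; apply: le_trans xy _; rewrite ge_min lexx orbT.
have [n0 H] := growth eps eta eps0 eta0.
rewrite -lerBrDr; apply: limr_le; first exact: entropy_cvg.
near=> n.
have n_gt0 : 0 < n%:R :> R by rewrite ltr0n; near: n; exists 1%N.
have n1 : 1 <= n%:R * eta by rewrite -ler_pdivrMr //; near: n; exact: nbhs_infty_ger.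
have n0n : (n0 <= n)%N by near: n; exists n0.
have [F spF sumF] := H n n0n.
have := spanning_entropy_bound cX cf cg inv pP cB BP k0 (ltW eps0) epsd gap modg' spF sumF.
rewrite expRK ler_pdivrMl // => bound.
have : n%:R * (eta + #|I|%:R * kappa - ln kappa * \sum_i mass nu (P i `\` B i)) <=
    n%:R * (3 * eta).
  by rewrite ler_pM2l //; lra.
have : n%:R * e = 5 * (n%:R * eta) by rewrite /eta; field.
rewrite [n%:R * (e - _)]mulrBr; move: bound n1; set u := n%:R * (_ - _).
by set v := n%:R * eta; rewrite [_ * (3 * _)]mulrCA -/v; lra.
Unshelve. all: by end_near. Qed.

End EntropyUpper.

(** * The Borel measure represented by a finitely additive probability *)

Record additive_prob (R : realType) (T : Type) := AdditiveProb {
  ap_val :> set T -> R ;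
  ap_ge0 : forall A, 0 <= ap_val A ;
  ap_setT : ap_val setT = 1 ;
  ap_setU : forall A B, A `&` B = set0 -> ap_val (A `|` B) = ap_val A + ap_val B }.

Section AdditiveProb.
Context {R : realType} {T : Type} (m : additive_prob R T).

Lemma ap_le A B : A `<=` B -> m A <= m B.
Proof.
by move=> AB; rewrite -(setDUK AB) ap_setU ?setDIK // lerDl ap_ge0.
Qed.

Lemma ap_le1 A : m A <= 1.
Proof. by rewrite -(ap_setT m) ap_le. Qed.

Lemma ap_setC A : m (~` A) = 1 - m A.
Proof. by rewrite -(ap_setT m) -(setUv A) ap_setU ?setICr // addrAC subrr add0r. Qed.

Lemma ap_set0 : m set0 = 0.
Proof. by rewrite -setCT ap_setC ap_setT subrr. Qed.

Lemma ap_setU_le A B : m (A `|` B) <= m A + m B.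
Proof.
rewrite -(setDUK (@subsetUl _ A B)) ap_setU ?setDIK // lerD2l ap_le //.
by move=> x [[Ax|//] /(_ Ax)].
Qed.

End AdditiveProb.

Section Representation.
Context {R : realType} {X : pmetricType R} (m : additive_prob R X).
Implicit Types (A B O K : set X).

(** The values on open sets of the regular measure defined by [m]; [outer] extends
    them to all sets from outside. *)
Definition inner O : R := sup [set m K | K in [set K | closed K /\ K `<=` O]].

Definition outer A : R := inf [set inner O | O in [set O | open O /\ A `<=` O]].

Lemma inner_has_sup O : has_sup [set m K | K in [set K | closed K /\ K `<=` O]].
Proof.
split; first by exists (m set0), set0 => //; split; [exact: closed0|exact: sub0set].
by exists 1 => _ [K _ <-]; exact: ap_le1.
Qed.

Lemma inner_ge O K : closed K -> K `<=` O -> m K <= inner O.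
Proof. by move=> cK KO; apply: ub_le_sup; [exact: (inner_has_sup O).2|exists K]. Qed.

Lemma inner_le O c : (forall K, closed K -> K `<=` O -> m K <= c) -> inner O <= c.
Proof.
by move=> H; apply: ge_sup; [exact: (inner_has_sup O).1|move=> _ [K [cK KO] <-]; exact: H].
Qed.

Lemma inner_ge0 O : 0 <= inner O.
Proof.
by rewrite -(ap_set0 m); apply: inner_ge; [exact: closed0|exact: sub0set].
Qed.

Lemma inner_mono O O' : O `<=` O' -> inner O <= inner O'.
Proof.
by move=> OO'; apply: inner_le => K cK KO; apply: inner_ge => //; exact: subset_trans OO'.
Qed.

Lemma inner_le_ap O : inner O <= m O.
Proof. by apply: inner_le => K _; exact: ap_le. Qed.

Lemma innerT : inner setT = 1.
Proof.
apply/eqP; rewrite eq_le -[X in _ <= X](ap_setT m) inner_le_ap /= -[X in X <= _](ap_setT m).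
by apply: inner_ge => //; exact: closedT.
Qed.

Lemma inner0 : inner set0 = 0.
Proof.
by apply/eqP; rewrite eq_le inner_ge0 andbT -[X in _ <= X](ap_set0 m) inner_le_ap.
Qed.

Lemma outer_has_inf A : has_inf [set inner O | O in [set O | open O /\ A `<=` O]].
Proof.
split; first by exists (inner setT), setT => //; split => //; exact: openT.
by exists 0 => _ [ O _ <-]; exact: inner_ge0.
Qed.

Lemma outer_le A O : open O -> A `<=` O -> outer A <= inner O.
Proof. by move=> oO AO; apply: ge_inf; [exact: (outer_has_inf A).2|exists O]. Qed.

Lemma outer_ge A c : (forall O, open O -> A `<=` O -> c <= inner O) -> c <= outer A.
Proof.
by move=> H; apply: lb_le_inf; [exact: (outer_has_inf A).1|move=> _ [ O [oO AO] <-]; exact: H].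
Qed.

Lemma outer_ge0 A : 0 <= outer A.
Proof. by apply: outer_ge => O _ _; exact: inner_ge0. Qed.

Lemma outer_open O : open O -> outer O = inner O.
Proof.
move=> oO; apply/eqP; rewrite eq_le outer_le //=.
by apply: outer_ge => O' _; exact: inner_mono.
Qed.

Lemma outer_mono A B : A `<=` B -> outer A <= outer B.
Proof.
by move=> AB; apply: outer_ge => O oO BO; apply: outer_le => //; exact: subset_trans BO.
Qed.

Lemma outer_adherent A e : 0 < e -> exists O, [/\ open O, A `<=` O & inner O <= outer A + e].
Proof.
move=> e0; have [_ [ O [oO AO] <-] Oe] := inf_adherent e0 (outer_has_inf A).
by exists O; split => //; exact: ltW.
Qed.

(** A closed set covered by two open sets is the union of two closed pieces,
    one in each; this is where normality of the space enters. *)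
Lemma closed_split K O1 O2 : compact [set: X] -> closed K -> open O1 -> open O2 ->
  K `<=` O1 `|` O2 -> exists K1 K2, [/\ closed K1, closed K2, K1 `<=` O1,
    K2 `<=` O2 & K = K1 `|` K2].
Proof.
move=> cX cK o1 o2 KO; have /normal_openP nX := compact_normal (@metric_hausdorff _ X) cX.
have [|||V [W [oV oW AV BW VW]]] := nX R (K `\` O1) (K `\` O2).
- by rewrite setDE; apply: closedI => //; exact: open_closedC.
- by rewrite setDE; apply: closedI => //; exact: open_closedC.
- by apply/seteqP; split => // x [[Kx n1] [_ n2]]; case: (KO x Kx).
exists (K `\` V), (K `\` W); split.
- by rewrite setDE; apply: closedI => //; exact: open_closedC.
- by rewrite setDE; apply: closedI => //; exact: open_closedC.
- by move=> x [Kx nV]; apply: contrapT => n1; apply/nV/AV.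
- by move=> x [Kx nW]; apply: contrapT => n2; apply/nW/BW.
- apply/seteqP; split => [x Kx|x [[]|[]]//].
  have [Vx|nVx] := pselect (V x); [right; split => // Wx|by left].
  by have : (V `&` W) x by []; rewrite VW.
Qed.

Lemma ap_closed_cover K (O : nat -> set X) n : compact [set: X] -> closed K ->
  (forall i, open (O i)) -> K `<=` \big[setU/set0]_(i < n) O i ->
  m K <= \sum_(i < n) inner (O i).
Proof.
move=> cX + oO; elim: n K => [|n IH] K cK.
  by rewrite !big_ord0 => /(ap_le m); rewrite ap_set0.
rewrite !big_ord_recr /= => KO.
have oU : open (\big[setU/set0]_(i < n) O i).
  by rewrite -bigcup_mkord; apply: bigcup_open => i _; exact: oO.
have [K1 [K2 [c1 c2 KO1 KO2 ->]]] := closed_split cX cK oU (oO n) KO.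
apply: le_trans (ap_setU_le _ _ _) _; apply: lerD; first exact: IH.
exact: inner_ge.
Qed.

(** Compactness of [K] reduces countable covers to finite ones. *)
Lemma inner_bigcup_le K (O : nat -> set X) : compact [set: X] -> closed K ->
  (forall i, open (O i)) -> K `<=` \bigcup_i O i ->
  exists n, m K <= \sum_(i < n) inner (O i).
Proof.
move=> cX cK oO KO; have : compact K by exact: (subclosed_compact cK cX).
rewrite compact_cover => /(_ nat setT O (fun i _ => oO i)) [|D _ KD].
  by move=> x /KO.
exists (\max_(i <- enum_fset D) i).+1; apply: ap_closed_cover => // x /KD[i /= iD Oi].
rewrite -bigcup_mkord; exists i => //=; rewrite ltnS.
by rewrite (big_rem i) //= leq_maxl.
Qed.

End Representation.

(** Subadditivity of the outer measure rests on compactness; recording it in the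
    argument of the outer measure makes it available to instance inference. *)
Record compact_additive_prob (R : realType) (X : pmetricType R) := CompactAdditiveProb {
  cap_prob :> additive_prob R X ;
  cap_compact : compact [set: X] }.

Section OuterMeasure.
Context {R : realType} {X : pmetricType R} (c : compact_additive_prob X).
Implicit Types (A B O K : set X).

Definition outer_ext A : \bar R := (outer c A)%:E.

Lemma outer_ext0 : outer_ext set0 = 0%E.
Proof. by rewrite /outer_ext outer_open ?inner0 //; exact: open0. Qed.

Lemma outer_ext_ge0 A : (0 <= outer_ext A)%E.
Proof. by rewrite lee_fin outer_ge0. Qed.

Lemma outer_ext_mono : {homo outer_ext : A B / A `<=` B >-> (A <= B)%E}.
Proof. by move=> A B AB; rewrite lee_fin outer_mono. Qed.

Lemma outer_ext_sigma_subadditive : sigma_subadditive outer_ext.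
Proof.
move=> F; apply/lee_addgt0Pr => e e0.
have /choice[ O OP] : forall i, exists O, [/\ open O, F i `<=` O &
    inner c O <= outer c (F i) + e / (2 ^ i.+1)%:R].
  by move=> i; apply: outer_adherent; rewrite divr_gt0 // ltr0n expn_gt0.
have oO i : open (O i) by have [] := OP i.
apply: le_trans (epsilon_trick xpredT (fun i => outer_ext_ge0 (F i)) (ltW e0)).
have b0 i : (0 <= outer_ext (F i) + (e / (2 ^ i.+1)%:R)%:E)%E.
  by rewrite adde_ge0 ?outer_ext_ge0 // lee_fin divr_ge0 // ltW.
apply: (@le_trans _ _ (inner c (\bigcup_i O i))%:E).
  rewrite lee_fin; apply: outer_le; first by apply: bigcup_open.
  by move=> x [i _ Fi]; exists i => //; have [_ + _] := OP i; exact.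
have fin : forall K, closed K -> K `<=` \bigcup_i O i ->
    ((c K)%:E <= \sum_(i <oo) (outer_ext (F i) + (e / (2 ^ i.+1)%:R)%:E))%E.
  move=> K cK KO; have [n Kn] := inner_bigcup_le c (cap_compact c) cK oO KO.
  apply: (@le_trans _ _ (\sum_(0 <= i < n) (outer_ext (F i) + (e / (2 ^ i.+1)%:R)%:E))%E).
    rewrite big_mkord.
    apply: (@le_trans _ _ (\sum_(i < n) inner c (O i))%:E); first by rewrite lee_fin.
    rewrite -sumEFin; apply: lee_sum => i _; rewrite -EFinD lee_fin.
    by have [] := OP i.
  by apply: nneseries_lim_ge => i _.
move: fin; case: (\sum_(i <oo) _)%E => [r| |] fin; last 2 first.
- by rewrite leey.
- by have := fin set0 closed0 (@sub0set _ _); rewrite leeNy_eq.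
rewrite lee_fin; apply: inner_le => K cK KO; rewrite -lee_fin; exact: fin.
Qed.

HB.instance Definition _ := isOuterMeasure.Build R X outer_ext
  outer_ext0 outer_ext_ge0 outer_ext_mono outer_ext_sigma_subadditive.

(** Inside an open set [G] that contains [E], fill [G] intersected with [O] by a closed
    set [K], then the rest [G] minus [K] by a closed set [L]; finite additivity on the
    disjoint union of [K] and [L] bounds the sum by the value of [G]. *)
Lemma open_caratheodory O : open O -> outer_ext.-caratheodory O.
Proof.
move=> oO; apply: le_caratheodory_measurable => E; rewrite -EFinD lee_fin.
apply: outer_ge => G oG EG.
have H1 K : closed K -> K `<=` G `&` O -> c K + outer c (E `&` ~` O) <= inner c G.
  move=> cK KGO; have oGK : open (G `&` ~` K) by apply: openI => //; exact: closed_openC.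
  apply: (@le_trans _ _ (c K + inner c (G `&` ~` K))).
    rewrite lerD2l; apply: outer_le => // x [Ex nOx]; split; first exact: EG.
    by move=> /KGO[].
  rewrite -lerBrDl; apply: inner_le => L cL LGK; rewrite lerBrDl -ap_setU.
    apply: inner_ge; first exact: closedU.
    by move=> x [/KGO[]|/LGK[]].
  by apply/seteqP; split => // x [Kx /LGK[_]].
rewrite -lerBrDr; apply: le_trans (_ : inner c (G `&` O) <= _).
  by apply: outer_le; [exact: openI|move=> x [Ex Ox]; split => //; exact: EG].
by apply: inner_le => K cK KGO; rewrite lerBrDr; exact: H1.
Qed.

Lemma borel_caratheodory A : borel_set A -> outer_ext.-caratheodory A.
Proof.
move: A; apply: smallest_sub => [|O]; last exact: open_caratheodory.
split.
- exact: caratheodory_measurable_set0.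
- by move=> A cA; rewrite setTD; exact: caratheodory_measurable_setC.
- exact: caratheodory_measurable_bigcup.
Qed.

Definition outer_borel (A : set (borel X)) : \bar R := outer_ext A.

Lemma outer_borel0 : outer_borel set0 = 0%E. Proof. exact: outer_ext0. Qed.

Lemma outer_borel_ge0 A : (0 <= outer_borel A)%E. Proof. exact: outer_ext_ge0. Qed.

Lemma outer_borel_sigma_additive : semi_sigma_additive outer_borel.
Proof.
move=> F mF tF mU.
apply: (caratheodory_measure_sigma_additive (mu := outer_ext)) => //.
- by move=> i; exact: (borel_caratheodory (mF i)).
- exact: (borel_caratheodory mU).
Qed.

HB.instance Definition _ := isMeasure.Build _ (borel X) R outer_borel
  outer_borel0 outer_borel_ge0 outer_borel_sigma_additive.

Lemma outer_borelT : outer_borel setT = 1%E.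
Proof. by rewrite /outer_borel /outer_ext outer_open ?innerT //; exact: openT. Qed.

HB.instance Definition _ := Measure_isProbability.Build _ (borel X) R outer_borel
  outer_borelT.

End OuterMeasure.

(** The measure is at most [m] on open sets ([inner_le_ap]), hence at least [m] on
    closed sets; weak convergence is used in this form. *)
Lemma representing_probability (R : realType) (X : pmetricType R)
    (m : additive_prob R X) : compact [set: X] ->
  exists nu : probability (borel X) R, forall O, open O -> mass nu O = inner m O.
Proof.
move=> cX; exists (outer_borel (CompactAdditiveProb m cX)) => O oO.
by rewrite /mass /outer_borel /outer_ext /= outer_open.
Qed.

(** * Continuity sets, and partitions into small continuity sets *)

Section Pushforward.
Context {R : realType} {X : pmetricType R}.
Implicit Types (nu : probability (borel X) R).

Lemma image_probability nu (f : X -> X) : continuous f ->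
  exists nu' : probability (borel X) R, forall A, mass nu' A = mass nu (f @^-1` A).
Proof.
move=> cf; have mf : measurable_fun [set: borel X] (f : borel X -> borel X).
  by move=> _ A mA; rewrite setTI; exact: continuous_borel_preimage.
pose F : {mfun borel X >-> borel X} :=
  HB.pack (f : borel X -> borel X) (isMeasurableFun.Build _ _ _ _ (f : borel X -> borel X) mf).
by exists (distribution nu F).
Qed.

(** The image of [nu] dominates [nu] on open sets, hence is equal to it by
    regularity. *)
Lemma invariant_of_open nu (f : X -> X) : continuous f ->
  (forall O, open O -> mass nu O <= mass nu (f @^-1` O)) -> invariant_measures f nu.
Proof.
move=> cf H A mA; have [nu' nu'E] := image_probability nu cf.
have mfA := continuous_borel_preimage cf mA.
rewrite [LHS](massE nu mfA) [RHS](massE nu mA) -nu'E; congr EFin; apply/esym.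
by apply: probability_le_open => // O oO; rewrite nu'E; exact: H.
Qed.

(** Sets with a null boundary.  With a sandwich in place of the closure and the
    interior, the stability under Boolean operations and preimages is immediate. *)
Definition continuity_set nu (A : set X) : Prop := exists O C,
  [/\ open O, closed C, O `<=` A, A `<=` C & mass nu (C `\` O) = 0].

Lemma continuity_setC nu A : continuity_set nu A -> continuity_set nu (~` A).
Proof.
move=> [ O [C [ oO cC OA AC n0]]]; exists (~` C), (~` O); split.
- exact: closed_openC.
- exact: open_closedC.
- exact: subsetC.
- exact: subsetC.
- by rewrite setDE setCK setIC -setDE.
Qed.

Lemma continuity_setI nu A B : continuity_set nu A -> continuity_set nu B ->
  continuity_set nu (A `&` B).
Proof.
move=> [ O1 [C1 [ o1 c1 OA1 AC1 n1]]] [ O2 [C2 [ o2 c2 OA2 AC2 n2]]].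
have m1 : borel_set (C1 `\` O1).
  by apply: measurableD; [exact: closed_borel|exact: open_borel].
have m2 : borel_set (C2 `\` O2).
  by apply: measurableD; [exact: closed_borel|exact: open_borel].
exists (O1 `&` O2), (C1 `&` C2); split.
- exact: openI.
- exact: closedI.
- exact: setISS.
- exact: setISS.
- have mU : borel_set ((C1 `\` O1) `|` (C2 `\` O2)) by exact: measurableU.
  apply: mass_null_sub mU _ _.
  + apply: measurableD; first exact: (closed_borel (closedI c1 c2)).
    exact: (open_borel (openI o1 o2)).
  + move=> x [[C1x C2x] nO]; have [inO1|nO1] := pselect (O1 x); last by left.
    by right; split => // O2x; apply: nO.
  + by apply/eqP; rewrite eq_le mass_ge0 andbT (le_trans (massU_le nu m1 m2)) // n1 n2 addr0.
Qed.

Lemma continuity_setT nu : continuity_set nu setT.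
Proof.
by exists setT, setT; split => //; [exact: openT|rewrite setDv mass0].
Qed.

Lemma continuity_set_preimage nu f A : continuous f -> invariant_measures f nu ->
  continuity_set nu A -> continuity_set nu (f @^-1` A).
Proof.
move=> cf inv [ O [C [ oO cC OA AC n0]]]; exists (f @^-1` O), (f @^-1` C).
have /continuousP cfo := cf; have /continuous_closedP cfc := cf; split.
- exact: cfo.
- exact: cfc.
- exact: preimage_subset.
- exact: preimage_subset.
- rewrite -[_ `\` _]/(f @^-1` (C `\` O)) mass_preimage //.
  by apply: measurableD; [exact: closed_borel|exact: open_borel].
Qed.

Lemma continuity_set_iter nu f A n : continuous f -> invariant_measures f nu ->
  continuity_set nu A -> continuity_set nu (iter n f @^-1` A).
Proof.
move=> cf inv cA; elim: n => [//|n IH].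
rewrite (_ : _ @^-1` A = f @^-1` (iter n f @^-1` A)); first exact: continuity_set_preimage.
by apply/funext => x; rewrite /preimage /= -iterS iterSr.
Qed.

(** Invariance makes preimages of null boundaries null. *)
Lemma continuity_set_join (I : finType) nu f (P : I -> set X) n s :
  continuous f -> invariant_measures f nu -> (forall i, continuity_set nu (P i)) ->
  continuity_set nu (@join _ _ I f P n s).
Proof.
move=> cf inv cP.
have -> : join f P s = \big[setI/setT]_(i < n) (iter i f @^-1` P (s i)).
  rewrite -bigcap_seq; apply/seteqP; split => x H i; first by move=> _; exact: H.
  by apply: (H i) => /=; rewrite mem_index_enum.
elim/big_ind: _ => [|A B|i _]; [exact: continuity_setT|exact: continuity_setI|].
exact: continuity_set_iter.
Qed.

(** [nu O <= m O <= m A <= m C <= nu C] for the two sides of the sandwich. *)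
Lemma mass_continuity_set nu (m : additive_prob R X) A :
  (forall O, open O -> mass nu O = inner m O) -> borel_set A ->
  continuity_set nu A -> mass nu A = m A.
Proof.
move=> nuE mA [ O [C [ oO cC OA AC n0]]].
have mO := open_borel oO; have mC := closed_borel cC.
have OC : mass nu C <= mass nu O.
  by apply: le_trans (mass_le_D nu mO mC) _; rewrite n0 addr0.
have leO U : open U -> mass nu U <= m U by move=> oU; rewrite nuE // inner_le_ap.
have := leO _ (closed_openC cC); rewrite mass_setC // ap_setC lerD2l lerN2 => mCC.
have := le_mass nu mO mA OA; have := le_mass nu mA mC AC.
have := ap_le m OA; have := ap_le m AC; have := leO _ oO => *.
apply/eqP; rewrite eq_le; apply/andP; split; lra.
Qed.

Lemma sphere_borel (x : X) r : borel_set [set y | mdist x y = r].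
Proof.
rewrite (_ : [set _ | _] = [set y | mdist x y <= r] `&` [set y | r <= mdist x y]).
  by apply: measurableI; apply: closed_borel; [exact: closed_mdist_le|exact: closed_mdist_ge].
apply/seteqP; split => y /=; first by move=> ->; split.
by move=> [h1 h2]; apply/eqP; rewrite eq_le h1.
Qed.

(** Only countably many of the disjoint spheres around a point are charged. *)
Lemma null_sphere nu (x : X) (a b : R) : a < b ->
  exists r, [/\ a < r, r < b & mass nu [set y | mdist x y = r] = 0].
Proof.
move=> ab; apply: contrapT => H; pose S r := [set y | mdist x y = r].
have pos r : a < r -> r < b -> 0 < mass nu (S r).
  move=> ar rb; rewrite lt_neqAle mass_ge0 andbT eq_sym; apply/eqP => S0.
  by apply: H; exists r.
pose D n := [set r | n.+1%:R^-1 <= mass nu (S r)].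
have tS (A : set R) : trivIset A S by move=> r r' _ _ [y [/= <- <-]].
have fD n : finite_set (D n).
  apply: contrapT => /(infinite_set_fset n.+2)[B BD sB].
  have := @measure_fbigsetU _ _ _ nu _ B S (fun r _ => sphere_borel x r) (tS _).
  have mU : borel_set (\big[setU/set0]_(i <- enum_fset B) S i).
    by apply: bigsetU_measurable => r _; exact: sphere_borel.
  rewrite [X in X = _ -> _](massE nu mU) (eq_bigr (fun r => (mass nu (S r))%:E)); last first.
    by move=> r _; apply: massE; exact: sphere_borel.
  rewrite sumEFin => -[BE]; have := mass_le1 nu mU; rewrite BE leNgt => /negP; apply.
  apply: (@lt_le_trans _ _ (\sum_(r <- enum_fset B) n.+1%:R^-1)).
    rewrite big_const_seq count_predT iter_addr_0 -[_ *+ size _]mulr_natl.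
    rewrite ltr_pdivlMr ?mul1r ?ltr0n //.
    by rewrite ltr_nat.
  by rewrite !big_seq; apply: ler_sum => r rB; apply: BD.
have cD : countable (\bigcup_n D n).
  by apply: bigcup_countable => // n _; exact: finite_set_countable.
have sub : `]a, b[%classic `<=` \bigcup_n D n.
  move=> r /=; rewrite in_itv /= => /andP[ar rb].
  near \oo => n; exists n => //; apply: ltW.
  by near: n; exact: near_infty_natSinv_lt (PosNum (pos r ar rb)).
have := countable_lebesgue_measure0 (sub_countable (subset_card_le sub) cD).
by rewrite lebesgue_measure_itv /= lte_fin ab => -[] /eqP; rewrite subr_eq0 gt_eqF.
Unshelve. all: by end_near. Qed.

Lemma continuity_ball nu (x : X) (r : R) : mass nu [set y | mdist x y = r] = 0 ->
  continuity_set nu [set y | mdist x y < r].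
Proof.
move=> S0; exists [set y | mdist x y < r], [set y | mdist x y <= r]; split => //.
- exact: open_mdist_lt.
- exact: closed_mdist_le.
- by move=> y /= /ltW.
- rewrite -S0; congr mass; apply/seteqP; split => y /=.
    by rewrite le_eqVlt => -[/orP[/eqP|]].
  by move=> ->; rewrite ltxx lexx.
Qed.

Lemma continuity_bigsetU nu (A : nat -> set X) n :
  (forall i, continuity_set nu (A i)) -> continuity_set nu (\big[setU/set0]_(i < n) A i).
Proof.
move=> cA; elim/big_ind: _ => [|B C cB cC|i _ //].
  by rewrite -setCT; exact/continuity_setC/continuity_setT.
rewrite -[B `|` C]setCK setCU; apply: continuity_setC.
by apply: continuity_setI; exact: continuity_setC.
Qed.

(** Cover the space by finitely many balls with null spheres and make them
    disjoint. *)
Lemma small_continuity_partition nu eps : compact [set: X] -> 0 < eps ->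
  exists k (P : 'I_k -> set X), [/\ is_partition P,
    forall i x y, P i x -> P i y -> mdist x y <= eps &
    forall i, continuity_set nu (P i)].
Proof.
move=> cX eps0.
have /choice[r rP] : forall x : X, exists r, [/\ 0 < r, r < eps / 2 &
    mass nu [set y | mdist x y = r] = 0].
  by move=> x; apply: null_sphere; rewrite divr_gt0.
have := cX; rewrite compact_cover => /(_ _ setT (fun x => [set y | mdist x y < r x])).
case=> [x _|x _|D _ cov]; first exact: open_mdist_lt.
  by exists x => //=; rewrite mdistxx; have [] := rP x.
pose s := enum_fset D; pose F i := [set y | mdist (nth point s i) y < r (nth point s i)].
have cF i : continuity_set nu (F i) by apply: continuity_ball; have [] := rP (nth point s i).
exists (size s), (fun i => seqDU F i); split.
- split => [i|i j _ _ ij|].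
  + apply: measurableD; first by apply: open_borel; exact: open_mdist_lt.
    by apply: bigsetU_measurable => j _; apply: open_borel; exact: open_mdist_lt.
  + by apply: val_inj; exact: (@trivIset_seqDU _ F i j Logic.I Logic.I ij).
  + apply/seteqP; split => // x _; have [y yD xy] := cov x Logic.I.
    have [i Fix i_min] : exists2 i, F i x & forall j, (j < i)%N -> ~ F j x.
      have ex : exists i, `[< F i x >].
        by exists (index y s); apply/asboolP; rewrite /F /= nth_index.
      exists (ex_minn ex); first by case: ex_minnP => i /asboolP.
      by case: ex_minnP => i _ mini j ji Fj; have := mini j (asboolT Fj); rewrite leqNgt ji.
    have is_lt : (i < size s)%N.
      rewrite ltnNge; apply/negP => si; apply: (i_min (index y s)).
        by apply: leq_trans si; rewrite index_mem.
      by rewrite /F /= nth_index.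
    exists (Ordinal is_lt) => //; split => //=.
    by rewrite -bigcup_mkord => -[j /= ji]; exact: i_min.
- move=> i x y [Fx _] [Fy _]; have [_ r2 _] := rP (nth point s i).
  apply: le_trans (metric_triangle x (nth point s i) y) _; rewrite metric_sym.
  by move: Fx Fy; rewrite /F /=; lra.
- move=> i; rewrite /seqDU setDE; apply: continuity_setI => //.
  by apply: continuity_setC; exact: continuity_bigsetU.
Qed.

End Pushforward.

(** * A lower bound for entropy by sums over separated sets *)

Section SeparatedSums.
Context {R : realType} {X : pmetricType R} (f : X -> X).

Lemma sum_blocks (F : nat -> R) (q T : nat) :
  \sum_(j < q) \sum_(i < T) F (j + i * q)%N = \sum_(m < T * q) F m.
Proof.
rewrite exchange_big /=; elim: T => [|T IH]; first by rewrite mul0n !big_ord0.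
rewrite big_ord_recr /= IH mulSn addnC big_split_ord /=; congr (_ + _).
by apply: eq_bigr => j _; rewrite addnC.
Qed.

Definition word (I : finType) (c : X -> I) q (x : X) : {ffun 'I_q -> I} :=
  [ffun i : 'I_q => c (iter i f x)].

Definition gibbs_weight (S : X -> R) (E : seq X) (x : X) : R :=
  expR (S x) / \sum_(y <- E) expR (S y).

Lemma sum_expR_gt0 (S : X -> R) (E : seq X) : (0 < size E)%N ->
  0 < \sum_(y <- E) expR (S y).
Proof.
case: E => // x E _; rewrite big_cons ltr_pwDl ?expR_gt0 //.
by apply: sumr_ge0 => y _; exact: expR_ge0.
Qed.

Lemma gibbs_weight_ge0 (S : X -> R) (E : seq X) x : 0 <= gibbs_weight S E x.
Proof. by rewrite divr_ge0 ?expR_ge0 // sumr_ge0 // => y _; exact: expR_ge0. Qed.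

Lemma sum_gibbs_weight (S : X -> R) (E : seq X) : (0 < size E)%N ->
  \sum_(x <- E) gibbs_weight S E x = 1.
Proof. by move=> E0; rewrite -mulr_suml divff // gt_eqF // sum_expR_gt0. Qed.

(** For every offset [j < q], Gibbs' inequality compares the weights on [E] with
    the product law of the consecutive blocks of length [q] starting at [j]; the
    first [q] letters, which include those before [j], are given the uniform law.
    Summing over the offsets, each time below [n] starts exactly one block.  The
    starting times overrun [n] by at most [q], which costs at most [q * C]. *)
Lemma separated_sum_bound (I : finType) (c : X -> I) (S : X -> R) (E : seq X)
    (n q : nat) (r : {ffun 'I_q -> I} -> R) (C : R) :
  (0 < q)%N -> (0 < size E)%N -> uniq E ->
  (forall x y, x \in E -> y \in E ->
    (forall m, (m < n)%N -> c (iter m f x) = c (iter m f y)) -> x = y) ->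
  (forall s, 0 < r s <= 1) -> \sum_s r s = 1 -> (forall s, - ln (r s) <= C) ->
  q%:R * ln (\sum_(x <- E) expR (S x)) <=
  q%:R * \sum_(x <- E) gibbs_weight S E x * S x +
  \sum_(x <- E) gibbs_weight S E x * \sum_(m < n) - ln (r (word c q (iter m f x))) +
  q%:R * (ln #|{ffun 'I_q -> I}|%:R + C).
Proof.
move=> q0 E0 uE injE r01 sumr rC.
set Z := \sum_(x <- E) expR (S x); set p := gibbs_weight S E.
have Z0 : 0 < Z by exact: sum_expR_gt0.
set K : R := #|{ffun 'I_q -> I}|%:R.
have [x0 x0E] : exists x0, x0 \in E by case: (E) E0 => // x s _; exists x; rewrite mem_head.
have K0 : 0 < K.
  by rewrite ltr0n; apply/card_gt0P; exists (word c q x0).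
pose phi x := - ln (r (word c q x)).
have phi0 x : 0 <= phi x by rewrite oppr_ge0 ln_le0 //; have /andP[] := r01 (word c q x).
pose T := (n %/ q).+1.
pose e (i : 'I_(size E)) := tnth (in_tuple E) i.
have eE i : e i \in E by exact: mem_tnth.
have sumE (F : X -> R) : \sum_(x <- E) F x = \sum_i F (e i) by rewrite big_tnth.
have offset (j : 'I_q) :
    ln Z <= \sum_(x <- E) p x * S x + ln K +
            \sum_(x <- E) p x * \sum_(i < T) phi (iter (j + i * q) f x).
  pose Q x := K^-1 * \prod_(i < T) r (word c q (iter (j + i * q) f x)).
  have Q0 x : 0 < Q x.
    rewrite mulr_gt0 ?invr_gt0 // prodr_gt0 // => i _.
    by have /andP[] := r01 (word c q (iter (j + i * q) f x)).
  have sumQ : \sum_i Q (e i) <= 1.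
    pose G (u : {ffun 'I_q -> I} * {ffun 'I_T -> {ffun 'I_q -> I}}) :=
      K^-1 * \prod_(i < T) r (u.2 i).
    pose h i := (word c q (e i),
      [ffun t : 'I_T => word c q (iter (j + t * q) f (e i))]).
    have injh : injective h.
      move=> a b [/ffunP hd /ffunP tl]; apply: (tuple_uniqP (in_tuple E) uE).
      apply: injE => [||m mn]; [exact: eE|exact: eE|].
      have [mq|qm] := ltnP m q.
        by have := hd (Ordinal mq); rewrite !ffunE.
      have jm : (j <= m)%N by apply: leq_trans qm; exact: ltnW.
      have tT : ((m - j) %/ q < T)%N.
        by rewrite ltnS leq_div2r // leq_subLR (leq_trans (ltnW mn)) // leq_addl.
      have lq : ((m - j) %% q < q)%N by rewrite ltn_mod.
      have := tl (Ordinal tT); rewrite !ffunE => /ffunP/(_ (Ordinal lq)).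
      rewrite !ffunE /= -!iterD.
      have -> : ((m - j) %% q + (j + (m - j) %/ q * q) = m)%N.
        by rewrite addnCA [X in (j + X)%N]addnC -divn_eq subnKC.
      by [].
    have G0 u : 0 <= G u.
      apply: mulr_ge0; first by rewrite invr_ge0 ltW.
      apply: prodr_ge0 => i _.
      by have /andP[/ltW] := r01 (u.2 i).
    rewrite (eq_bigr (fun i => G (h i))); last first.
      by move=> i _; rewrite /G /Q /=; congr (_ * _); apply: eq_bigr => t _; rewrite ffunE.
    apply: le_trans (sum_inj_le injh G0) _.
    rewrite -(pair_big xpredT xpredT (fun (_ : {ffun 'I_q -> I})
      (b : {ffun 'I_T -> {ffun 'I_q -> I}}) => K^-1 * \prod_(i < T) r (b i))) /=.
    have prod1 : \sum_(b : {ffun 'I_T -> {ffun 'I_q -> I}}) \prod_(i < T) r (b i) = 1.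
      by rewrite -(bigA_distr_bigA (fun (_ : 'I_T) s => r s)) /= big1.
    under eq_bigr do rewrite -mulr_sumr prod1 mulr1.
    by rewrite sumr_const -[X in X <= _]mulr_natl -/K divff ?gt_eqF.
  have := @gibbs R _ (p \o e) (Q \o e) 1 (fun i => gibbs_weight_ge0 _ _ _)
    (fun i => ltW (Q0 _)) _ _ sumQ.
  rewrite -(sumE p) -[X in - X <= _](sumE (fun x => p x * ln (p x))).
  rewrite -[X in _ <= _ - X](sumE (fun x => p x * ln (Q x))) ln1 sub0r lerN2 => G.
  have {}G : \sum_(x <- E) p x * ln (Q x) <= \sum_(x <- E) p x * ln (p x).
    apply: G => [i /= Qi0|]; first by have := Q0 (e i); rewrite Qi0 ltxx.
    exact: sum_gibbs_weight.
  have lnpE : \sum_(x <- E) p x * ln (p x) = \sum_(x <- E) p x * S x - ln Z.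
    rewrite -[X in _ = _ - X]mul1r -(sum_gibbs_weight S E0) mulr_suml -sumrB.
    apply: eq_bigr => x _; rewrite -mulrBr /p /gibbs_weight ln_div ?posrE ?expR_gt0 //.
    by rewrite expRK.
  have lnQE : \sum_(x <- E) p x * ln (Q x) =
      - ln K - \sum_(x <- E) p x * \sum_(i < T) phi (iter (j + i * q) f x).
    rewrite -[X in _ = - X - _]mul1r -(sum_gibbs_weight S E0) mulr_suml -sumrN -sumrB.
    apply: eq_bigr => x _; rewrite -mulrN -mulrBr; congr (_ * _).
    rewrite lnM ?posrE ?invr_gt0 //; last first.
      by rewrite prodr_gt0 // => i _; have /andP[] := r01 (word c q (iter (j + i * q) f x)).
    rewrite lnV ?posrE //; congr (_ + _).
    rewrite /phi sumrN opprK.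
    suff [] : 0 < \prod_(i < T) r (word c q (iter (j + i * q) f x)) /\
        ln (\prod_(i < T) r (word c q (iter (j + i * q) f x))) =
        \sum_(i < T) ln (r (word c q (iter (j + i * q) f x))) by [].
    elim/big_rec2: _ => [|i y z _ [z0 zE]]; first by rewrite ltr01 ln1.
    have /andP[ri _] := r01 (word c q (iter (j + i * q) f x)).
    by split; [exact: mulr_gt0|rewrite lnM ?posrE // zE].
  by move: G; rewrite lnpE lnQE; lra.
have step x : \sum_(j < q) \sum_(i < T) phi (iter (j + i * q) f x) <=
    \sum_(m < n) phi (iter m f x) + q%:R * C.
  rewrite (sum_blocks (fun m => phi (iter m f x))).
  have nT : (n <= T * q)%N.
    by rewrite ltnW // /T mulSn addnC [X in (X < _)%N](divn_eq n q) ltn_add2l ltn_mod.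
  have -> : (T * q = n + (T * q - n))%N by rewrite subnKC.
  rewrite big_split_ord /= lerD2l.
  apply: (@le_trans _ _ (\sum_(i < T * q - n) C)); first by apply: ler_sum => i _; exact: rC.
  rewrite sumr_const card_ord -[X in X <= _]mulr_natl ler_wpM2r //.
    by apply: le_trans (rC (word c q x0)); exact: phi0.
  by rewrite ler_nat leq_subLR /T mulSn [leqRHS]addnC leq_add2l leq_divM.
have sum1 : q%:R * ln Z <= q%:R * (\sum_(x <- E) p x * S x + ln K) +
    \sum_(j < q) \sum_(x <- E) p x * \sum_(i < T) phi (iter (j + i * q) f x).
  rewrite -[X in X%:R * ln Z](card_ord q) -[X in X%:R * (_ + _)](card_ord q).
  rewrite !mulr_natl -!sumr_const -big_split /=; apply: ler_sum => j _; exact: offset.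
have sum2 : \sum_(j < q) \sum_(x <- E) p x * \sum_(i < T) phi (iter (j + i * q) f x) <=
    \sum_(x <- E) p x * \sum_(m < n) phi (iter m f x) + q%:R * C.
  rewrite exchange_big /= -[X in _ <= _ + X]mul1r.
  rewrite -[X in _ <= _ + X * _](sum_gibbs_weight S E0) mulr_suml.
  rewrite -big_split /=; apply: ler_sum => x _; rewrite -mulr_sumr -mulrDr.
  by apply: ler_wpM2l; [exact: gibbs_weight_ge0|exact: step].
move: sum1 sum2; rewrite !mulrDr /phi; lra.
Qed.

End SeparatedSums.

Lemma ultra_cvg (R : realType) (T : Type) (U : set_system T) (u : T -> R) (M : R) :
  UltraFilter U -> (forall t, `|u t| <= M) -> cvg (u @ U).
Proof.
move=> UU uM.
have [|p [_ pcl]] := @segment_compact R (- M) M (u @ U) _.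
  suff : U (u @^-1` `[- M, M]%classic) by [].
  by apply: filterE => t; rewrite /= in_itv /= -ler_norml.
apply/cvg_ex; exists p => V Vp; have [//|nV] := in_ultra_setVsetC (u @^-1` V) UU.
by have [z [nVz Vz]] := pcl (~` V) V nV Vp; case: (nVz Vz).
Qed.

Lemma cvg_finer (T : Type) (Y : topologicalType) (F G : set_system T) (u : T -> Y) (l : Y) :
  F `<=` G -> u @ F --> l -> u @ G --> l.
Proof. by move=> FG uF A /uF; exact: FG. Qed.

Lemma cvg_lincomb (R : realType) (I : finType) (T : Type) (U : set_system T)
    (u : I -> T -> R) (l F : I -> R) : Filter U -> (forall i, u i t @[t --> U] --> l i) ->
  \sum_i u i t * F i @[t --> U] --> \sum_i l i * F i.
Proof.
move=> FU ul; apply: cvg_big => [|i _]; first exact: add_continuous.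
by apply: cvgMl; exact: ul.
Qed.

Section Empirical.
Context {R : realType} {X : pmetricType R} (f : X -> X).

(** Only finitely many points are charged, so the set [A] is arbitrary. *)
Definition empirical (S : X -> R) (E : seq X) (n : nat) (A : set X) : R :=
  n%:R^-1 * \sum_(x <- E) gibbs_weight S E x * \sum_(i < n) \1_A (iter i f x).

Lemma empirical_ge0 S E n A : 0 <= empirical S E n A.
Proof.
rewrite mulr_ge0 ?invr_ge0 //; apply: sumr_ge0 => x _.
by rewrite mulr_ge0 ?gibbs_weight_ge0 // sumr_ge0.
Qed.

Lemma empirical_setT S E n : (0 < n)%N -> (0 < size E)%N -> empirical S E n setT = 1.
Proof.
move=> n0 E0; rewrite /empirical (eq_bigr (fun x => gibbs_weight S E x * n%:R)).
  by rewrite -mulr_suml sum_gibbs_weight // mul1r mulVf // pnatr_eq0 -lt0n.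
move=> x _; congr (_ * _); rewrite (eq_bigr (fun=> 1)) ?sumr_const ?card_ord //.
by move=> i _; rewrite indicT.
Qed.

Lemma empirical_setU S E n A B : A `&` B = set0 ->
  empirical S E n (A `|` B) = empirical S E n A + empirical S E n B.
Proof.
move=> AB; rewrite /empirical -mulrDr -big_split /=; congr (_ * _).
apply: eq_bigr => x _; rewrite -mulrDr -big_split /=; congr (_ * _).
apply: eq_bigr => i _; set y := iter i f x; rewrite !indicE in_setU.
case: (boolP (y \in A)) => Ay; case: (boolP (y \in B)) => By /=; rewrite ?addr0 ?add0r //.
have : (A `&` B) y by split; apply: set_mem.
by rewrite AB.
Qed.

Lemma empirical_le1 S E n A : (0 < n)%N -> (0 < size E)%N -> empirical S E n A <= 1.
Proof.
move=> n0 E0; rewrite -(empirical_setT S n0 E0) -(setUv A) empirical_setU ?setICr //.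
by rewrite lerDl empirical_ge0.
Qed.

(** Along an orbit, the sums over [A] and over its preimage telescope. *)
Lemma empirical_preimage S E n A : (0 < size E)%N ->
  `|empirical S E n (f @^-1` A) - empirical S E n A| <= n%:R^-1.
Proof.
move=> E0; rewrite /empirical -mulrBr normrM ger0_norm ?invr_ge0 //.
rewrite -[leRHS]mulr1 ler_wpM2l ?invr_ge0 // -sumrB -(sum_gibbs_weight S E0).
apply: le_trans (ler_norm_sum _ _ _) _; apply: ler_sum => x _.
rewrite -mulrBr normrM ger0_norm ?gibbs_weight_ge0 // -[leRHS]mulr1.
rewrite ler_wpM2l ?gibbs_weight_ge0 //.
have -> : \sum_(i < n) \1_(f @^-1` A) (iter i f x) =
    \sum_(0 <= i < n) \1_A (iter i.+1 f x) :> R.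
  by rewrite big_mkord; apply: eq_bigr => i _; rewrite !indicE.
have -> : \sum_(i < n) \1_A (iter i f x) = \sum_(0 <= i < n) \1_A (iter i f x) :> R.
  by rewrite big_mkord.
rewrite -sumrB telescope_sumr // !indicE.
by case: (_ \in _); case: (_ \in _); rewrite ?subrr ?subr0 ?sub0r ?normrN ?normr1 ?normr0.
Qed.

Lemma empirical_expect (I : finType) (P : I -> set X) (c : X -> I) S E n (F : I -> R) :
  (0 < n)%N -> (forall x i, P i x <-> c x = i) ->
  \sum_(x <- E) gibbs_weight S E x * \sum_(m < n) F (c (iter m f x)) =
  n%:R * \sum_i empirical S E n (P i) * F i.
Proof.
move=> n0 cP; under [in RHS]eq_bigr do rewrite /empirical -mulrA.
rewrite -mulr_sumr mulrA divff ?pnatr_eq0 -?lt0n // mul1r.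
under [in RHS]eq_bigr do rewrite mulr_suml.
rewrite exchange_big /=; apply: eq_bigr => x _.
under [in RHS]eq_bigr do rewrite -mulrA.
rewrite -mulr_sumr; congr (_ * _).
under [in RHS]eq_bigr do rewrite mulr_suml.
rewrite exchange_big /=; apply: eq_bigr => m _; set y := iter m f x.
rewrite (bigD1 (c y)) //= big1 => [|i ic].
  by rewrite addr0 indicE mem_set ?mul1r //; apply/cP.
by rewrite indicE memNset ?mul0r // => /cP ci; rewrite ci eqxx in ic.
Qed.

End Empirical.

Section EntropyLower.
Context {R : realType} {X : pmetricType R} (f : X -> X).

Definition separated n (eps : R) (E : seq X) : Prop := uniq E /\
  forall x y, x \in E -> y \in E -> bowen_dist f n x y <= eps -> x = y.

(** The ultrafilter selects a limit for all sets at once, so that additivity passes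
    to the limit; a subsequence would only serve countably many sets. *)
Lemma limit_additive_prob (U : set_system nat) (S : nat -> X -> R) (E : nat -> seq X)
    (n : nat -> nat) : UltraFilter U ->
  (forall N, (0 < n N)%N) -> (forall N, (0 < size (E N))%N) ->
  exists m : additive_prob R X,
    forall A, empirical f (S N) (E N) (n N) A @[N --> U] --> m A.
Proof.
move=> UU n0 E0; pose u A N := empirical f (S N) (E N) (n N) A.
have cu A : cvg (u A @ U).
  apply: (@ultra_cvg _ _ _ _ 1) => N.
  by rewrite ger0_norm ?empirical_ge0 // empirical_le1.
pose m A := lim (u A @ U).
have m0 A : 0 <= m A.
  by apply: limr_ge => //; apply: filterE => N; exact: empirical_ge0.
have mT : m setT = 1.
  rewrite /m (_ : u setT = fun=> 1); first exact: lim_cst.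
  by apply/funext => N; exact: empirical_setT.
have mU A B : A `&` B = set0 -> m (A `|` B) = m A + m B.
  move=> AB; rewrite /m -limD //; congr (lim (_ @ U)).
  by apply/funext => N; exact: empirical_setU.
by exists (AdditiveProb m0 mT mU) => A; exact: cu.
Qed.

(** The bound [separated_sum_bound] for the sets [E N] is linear in the empirical
    measures, so that it passes to the limit; the constant terms are divided by the
    length [n N], which tends to infinity.  The limits are values of [nu] because the
    cells are continuity sets. *)
Lemma entropy_ge_separated (g : X -> R) (eps a b : R) :
  compact [set: X] -> continuous f -> continuous g -> 0 < eps -> a < b ->
  (forall n0, exists n E, [/\ (n0 <= n)%N, separated n eps E &
     expR (n%:R * b) <= \sum_(x <- E) expR (birkhoff_sum f g n x)]) ->
  exists nu, invariant_measures f nu /\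
    exists k (P : 'I_k -> set X), finite_partition P /\
      a <= entropy_wrt nu f P + mean nu g.
Proof.
move=> cX cf cg eps0 ab H.
have /choice[nE nEP] : forall N, exists nE : nat * seq X, [/\ (N.+1 <= nE.1)%N,
    separated nE.1 eps nE.2 &
    expR (nE.1%:R * b) <= \sum_(x <- nE.2) expR (birkhoff_sum f g nE.1 x)].
  by move=> N; have [n [E nEP]] := H N.+1; exists (n, E).
pose n N := (nE N).1; pose E N := (nE N).2; pose S N := birkhoff_sum f g (n N).
have nN N : (N < n N)%N by have [] := nEP N.
have n0 N : (0 < n N)%N by exact: leq_ltn_trans (nN N).
have uE N : uniq (E N) by have [_ []] := nEP N.
have E0 N : (0 < size (E N))%N.
  have [_ _] := nEP N; rewrite -/(E N); case: (E N) => //.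
  by rewrite big_nil leNgt expR_gt0.
have [U [UU oU]] := ultraFilterLemma (eventually_filter : ProperFilter \oo).
have ninv : (n N)%:R^-1 @[N --> U] --> (0 : R).
  apply: (cvg_finer oU); apply/cvgrPdist_le => /= e e0; near=> N.
  rewrite sub0r normrN ger0_norm ?invr_ge0 //; apply: (@le_trans _ _ N.+1%:R^-1).
    by rewrite lef_pV2 ?posrE ?ltr0n // ler_nat.
  by apply: ltW; near: N; exact: near_infty_natSinv_lt (PosNum e0).
have [m mlim] := limit_additive_prob S UU n0 E0.
have minv A : m (f @^-1` A) = m A.
  apply/eqP; rewrite -subr_eq0; apply/eqP.
  have d : (empirical f (S N) (E N) (n N) (f @^-1` A) -
            empirical f (S N) (E N) (n N) A) @[N --> U] --> m (f @^-1` A) - m A.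
    by apply: cvgB; exact: mlim.
  apply: (cvg_unique _ d); first exact: norm_hausdorff.
  apply/cvgr0Pnorm_le => e e0.
  move/cvgr0Pnorm_le : ninv => /(_ e e0); apply: filterS => N.
  rewrite ger0_norm ?invr_ge0 //; apply: le_trans; exact: empirical_preimage.
have [nu nuE] := representing_probability m cX.
have inv : invariant_measures f nu.
  apply: (invariant_of_open cf) => O oO; have /continuousP cfo := cf.
  rewrite !nuE //; last exact: cfo.
  apply: inner_le => K cK KO; rewrite -minv; apply: inner_ge.
    by move: cK; have /continuous_closedP := cf; exact.
  exact: preimage_subset.
exists nu; split => //.
pose eta := (b - a) / 3; have eta0 : 0 < eta by rewrite divr_gt0 // subr_gt0.
have [d d0 modg] := compact_modulus cX cg eta0.
have dm : 0 < Num.min eps d by rewrite lt_min eps0.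
have [k [P [pP diamP cP]]] := small_continuity_partition nu cX dm.
exists k, P; split; first by exact: pP.
have [c cPE] := partition_index pP.
have bg := continuous_bounded_borel cX cg.
have /choice[pt ptP] : forall i, exists x, P i !=set0 -> P i x.
  by move=> i; have [[x Px]|nP] := pselect (P i !=set0); [exists x|exists point].
have modP i x y : P i x -> P i y -> `|g x - g y| <= eta.
  by move=> Px Py; apply: modg; apply: le_trans (diamP i x y Px Py) _; rewrite ge_min lexx orbT.
pose G i := g (pt i) + eta.
have gG y : g y <= G (c y).
  have Py : P (c y) y by apply/cPE.
  have := modP _ _ _ Py (ptP _ (ex_intro _ y Py)); rewrite ler_norml => /andP[_].
  by rewrite /G; lra.
have Gg i x : P i x -> (-1) * g x <= 2 * eta - G i.
  move=> Px; have := modP _ _ _ (ptP _ (ex_intro _ x Px)) Px.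
  by rewrite ler_norml => /andP[_]; rewrite /G; lra.
have meanG : \sum_i mass nu (P i) * G i <= mean nu g + 2 * eta.
  have := mean_le_partition nu pP (bounded_borelZ (-1) bg) Gg; rewrite meanZ //.
  under eq_bigr do rewrite mulrBr.
  by rewrite sumrB -mulr_suml sum_mass_partition //; lra.
have mP i : borel_set (P i) by case: pP.
have key q : (0 < q)%N ->
    q%:R * (b - mean nu g - 2 * eta) <= partition_entropy nu (@join _ _ _ f P q) + ln 2.
  move=> q0; have qR : 0 < q%:R :> R by rewrite ltr0n.
  set J := @join _ _ _ f P q; have pJ : is_partition J := join_partition q cf pP.
  have mJ s : borel_set (J s) by case: pJ.
  set K : R := #|{ffun 'I_q -> 'I_k}|%:R.
  have K1 : 1 <= K.
    by rewrite ler1n; apply/card_gt0P; exists (word f c q point).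
  have K0 : 0 < K by exact: lt_le_trans K1.
  (* half of the uniform law keeps the logarithms finite on null words *)
  pose r s := (mass nu (J s) + K^-1) / 2.
  have r_ge s : K^-1 / 2 <= r s by rewrite ler_pM2r // lerDr mass_ge0.
  have r0 s : 0 < r s by apply: lt_le_trans (r_ge s); rewrite divr_gt0 ?invr_gt0.
  have r01 s : 0 < r s <= 1.
    rewrite r0 /= ler_pdivrMr // mul1r [leRHS](_ : _ = 1 + 1); last by [].
    by rewrite lerD ?mass_le1 // invf_le1.
  have sumr : \sum_s r s = 1.
    rewrite -mulr_suml big_split /= sum_mass_partition // sumr_const -[X in _ + X]mulr_natl.
    by rewrite -/K divff ?gt_eqF // divff.
  pose phi s := - ln (r s).
  have rC s : phi s <= ln (K * 2).
    have Kr : (K^-1 / 2)^-1 = K * 2 by rewrite invfM !invrK.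
    have k2 : 0 < K^-1 / 2 by rewrite divr_gt0 ?invr_gt0.
    by rewrite -Kr lnV ?posrE // /phi lerN2 ler_ln ?posrE.
  have JE x s : J s x <-> word f c q x = s.
    split=> [Jx|<- i]; last by rewrite ffunE; apply/cPE.
    by apply/ffunP => i; rewrite ffunE; apply/cPE.
  pose rhs N := \sum_i empirical f (S N) (E N) (n N) (P i) * G i +
    q%:R^-1 * \sum_s empirical f (S N) (E N) (n N) (J s) * phi s +
    (n N)%:R^-1 * (ln K + ln (K * 2)).
  have rhs_ge N : b <= rhs N.
    have nR : 0 < (n N)%:R :> R by rewrite ltr0n.
    have inj x y : x \in E N -> y \in E N ->
        (forall i, (i < n N)%N -> c (iter i f x) = c (iter i f y)) -> x = y.
      move=> xE yE cxy; have [_ [_ sepE] _] := nEP N; apply: sepE => //.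
      apply/(bowen_dist_leP _ _ _ _ (ltW eps0)) => i iN.
      apply: le_trans (_ : Num.min eps d <= _); last by rewrite ge_min lexx.
      by apply: (diamP (c (iter i f x))); apply/cPE => //; rewrite cxy.
    have := separated_sum_bound (S N) q0 (E0 N) (uE N) inj r01 sumr rC.
    rewrite (empirical_expect f _ _ (fun s => - ln (r s)) (n0 N) JE).
    have : \sum_(x <- E N) gibbs_weight (S N) (E N) x * S N x <=
        (n N)%:R * \sum_i empirical f (S N) (E N) (n N) (P i) * G i.
      rewrite -(empirical_expect f _ _ _ (n0 N) cPE); apply: ler_sum => x _.
      by rewrite ler_wpM2l ?gibbs_weight_ge0 //; apply: ler_sum => i _; exact: gG.
    have : (n N)%:R * b <= ln (\sum_(x <- E N) expR (S N x)).
      rewrite -[leLHS]expRK ler_ln ?posrE ?expR_gt0 ?sum_expR_gt0 //.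
      by have [_ _] := nEP N.
    move=> h1 /(ler_wpM2l (ltW qR)) h2 h3; have {h1}h1 := ler_wpM2l (ltW qR) h1.
    have h := le_trans h1 (le_trans h3 (lerD (lerD h2 (lexx _)) (lexx _))).
    rewrite -(ler_pM2l (mulr_gt0 qR nR)); apply: le_trans (_ : _ <= _).
      by rewrite -mulrA; exact: h.
    rewrite le_eqVlt; apply/orP; left; apply/eqP; rewrite /rhs /phi.
    by field; rewrite !gt_eqF.
  have rhs_cvg : rhs N @[N --> U] --> \sum_i m (P i) * G i +
      q%:R^-1 * \sum_s m (J s) * phi s + 0 * (ln K + ln (K * 2)).
    apply: cvgD; last by apply: cvgMl.
    apply: cvgD; first by apply: cvg_lincomb => i; exact: mlim.
    by apply: cvgMr; apply: cvg_lincomb => s; exact: mlim.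
  have : b <= \sum_i m (P i) * G i + q%:R^-1 * \sum_s m (J s) * phi s.
    rewrite -[leRHS]addr0 -[X in _ + X](mul0r (ln K + ln (K * 2))).
    rewrite -(cvg_lim _ rhs_cvg) //; apply: limr_ge; last exact: filterE.
    by apply/cvg_ex; eexists; exact: rhs_cvg.
  have -> : \sum_i m (P i) * G i = \sum_i mass nu (P i) * G i.
    by apply: eq_bigr => i _; rewrite (mass_continuity_set nuE).
  have -> : \sum_s m (J s) * phi s = \sum_s mass nu (J s) * phi s.
    apply: eq_bigr => s _; rewrite (mass_continuity_set nuE) //.
    exact: continuity_set_join.
  have : \sum_s mass nu (J s) * phi s <= partition_entropy nu J + ln 2.
    rewrite partition_entropyE -[X in _ + X]mul1r -[X in _ + X * _](sum_mass_partition nu pJ).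
    rewrite mulr_suml -sumrN -big_split /=; apply: ler_sum => s _; rewrite -mulrN -mulrDr.
    have := mass_ge0 nu (J s); rewrite le_eqVlt => /orP[/eqP <-|Js0].
      by rewrite !mul0r.
    rewrite ler_pM2l // /phi.
    have : ln (mass nu (J s) / 2) <= ln (r s).
      have J2 : 0 < mass nu (J s) / 2 by rewrite divr_gt0.
      by rewrite ler_ln ?posrE // ler_pM2r // lerDl invr_ge0 ltW.
    by rewrite ln_div ?posrE //; lra.
  move=> h1 h2; have {}h2 : b - mean nu g - 2 * eta <= q%:R^-1 * (partition_entropy nu J + ln 2).
    have := ler_wpM2l (ltW (_ : 0 < q%:R^-1)) h1; rewrite invr_gt0 => /(_ qR); lra.
  by rewrite -ler_pdivlMl.
rewrite -lerBlDr /entropy_wrt; apply: limr_ge; first exact: entropy_cvg.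
near=> q; have q0 : (0 < q)%N by near: q; exists 1%N.
have qR : 0 < q%:R :> R by rewrite ltr0n.
have ln2q : ln 2 <= q%:R * eta by rewrite -ler_pdivrMr //; near: q; exact: nbhs_infty_ger.
rewrite ler_pdivlMl //; have := key q q0.
have -> : q%:R * (b - mean nu g - 2 * eta) = q%:R * (a - mean nu g) + q%:R * eta.
  by rewrite /eta; field.
rewrite -/(@join _ _ _ f P q); lra.
Unshelve. all: by end_near. Qed.

End EntropyLower.

(** * Maximal separated sets *)

Section MaximalSeparated.
Context {R : realType} {X : pmetricType R} (f : X -> X).

Lemma bowen_dist_sym n (x y : X) : bowen_dist f n x y = bowen_dist f n y x.
Proof. by apply: eq_bigr => i _; rewrite metric_sym. Qed.

Lemma bowen_dist_xx n (x : X) : bowen_dist f n x x = 0.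
Proof.
apply/eqP; rewrite eq_le; apply/andP; split.
  by apply/bowen_dist_leP => // i _; rewrite mdistxx.
by apply/bigmax_geP; left.
Qed.

(** A set of diameter at most [eps] for [bowen_dist f n] contains at most one point
    of a separated set, and finitely many such sets cover the space. *)
Lemma separated_size_bound n eps : compact [set: X] -> continuous f -> 0 < eps ->
  exists M, forall E, separated f n eps E -> (size E <= M)%N.
Proof.
move=> cX cf eps0.
pose V (x : X) := [set y | forall i : 'I_n, mdist (iter i f x) (iter i f y) < eps / 2].
have nV x : nbhs x (V x).
  apply: filter_forall => i; have := @iter_continuous _ _ f i cf x.
  move=> /(_ [set y | mdist (iter i f x) y < eps / 2]); apply.
  have := @nbhsx_ballx _ _ (iter i f x) (eps / 2); rewrite ballEmdist; apply.
  by rewrite divr_gt0.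
have := cX; rewrite compact_cover => /(_ _ setT (fun x => (V x)°)).
case=> [x _|x _|D _ cov]; [exact: open_interior|by exists x => //; exact: nV|].
have /choice[z zP] : forall x, exists z, z \in D /\ V z x.
  by move=> x; have [z zD /interior_subset Vz] := cov x Logic.I; exists z.
exists (size (enum_fset D)) => E [uE sepE]; rewrite -(size_map z); apply: uniq_leq_size.
  rewrite map_inj_in_uniq // => x y xE yE zxy; apply: sepE => //.
  apply/(bowen_dist_leP _ _ _ _ (ltW eps0)) => i i_n.
  have [_ /(_ (Ordinal i_n)) /= Vx] := zP x; have [_ /(_ (Ordinal i_n)) /= Vy] := zP y.
  apply: le_trans (metric_triangle _ (iter i f (z x)) _) _; rewrite metric_sym.
  by rewrite -zxy in Vy; lra.
by move=> _ /mapP[x _ ->]; have [] := zP x.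
Qed.

(** A separated set of maximal cardinality is spanning. *)
Lemma separated_spanning n eps : compact [set: X] -> continuous f -> 0 < eps ->
  exists E, separated f n eps E /\ spanning f n eps setT [set` E].
Proof.
move=> cX cf eps0; have [M EM] := separated_size_bound n cX cf eps0.
pose p k := `[< exists E, separated f n eps E /\ size E = k >].
have p0 : exists k, p k by exists 0%N; apply/asboolP; exists [::].
have pM k : p k -> (k <= M)%N by move=> /asboolP[E [sE <-]]; exact: EM.
have [k /asboolP[E [[uE sepE] Ek]] kmax] := ex_maxnP p0 pM.
exists E; split => // y _; apply: contrapT => far.
have nE x : x \in E -> ~ bowen_dist f n x y <= eps.
  by move=> xE xy; apply: far; exists x.
have : p k.+1.
  apply/asboolP; exists (y :: E); split; last by rewrite /= Ek.
  split => [|u v].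
    rewrite /= uE andbT; apply/negP => /nE; apply.
    by rewrite bowen_dist_xx ltW.
  rewrite !inE => /predU1P[->|uE'] /predU1P[->|vE'] //.
  - by rewrite bowen_dist_sym => /(nE _ vE').
  - by move=> /(nE _ uE').
  - exact: sepE.
by move=> /kmax; rewrite ltnn.
Qed.

End MaximalSeparated.

(** * Extended sums and finite subsums *)

Lemma sum_le_esum (R : realType) (T : choiceType) (D : set T) (a : T -> \bar R)
    (E : seq T) : uniq E -> (forall x, x \in E -> D x) ->
  (\sum_(x <- E) a x <= \esum_(x in D) a x)%E.
Proof.
move=> uE ED; apply: esum_ge; exists [set` E]; last by rewrite fsbig_seq.
by split; [exact: finite_seq|].
Qed.

Lemma esum_le (R : realType) (T : choiceType) (D : set T) (a : T -> R) (M : R) :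
  (forall E, uniq E -> (forall x, x \in E -> D x) -> \sum_(x <- E) a x <= M) ->
  (\esum_(x in D) (a x)%:E <= M%:E)%E.
Proof.
move=> H; apply: ge_ereal_sup => _ [F [fF FD] <-].
rewrite fsbig_finite //= sumEFin lee_fin; apply: H; first exact: fset_uniq.
by move=> x; rewrite in_fset_set // => /set_mem; exact: FD.
Qed.

Lemma sum_geometric_le (R : realType) (z : R) (s : seq nat) : 0 < z < 1 -> uniq s ->
  \sum_(n <- s) z ^+ n <= (1 - z)^-1.
Proof.
move=> /andP[z0 z1] us; pose N := (\max_(n <- s) n).+1.
have sN n : n \in s -> (n < N)%N.
  by move=> ns; rewrite ltnS (big_rem n) //= leq_maxl.
apply: (@le_trans _ _ (\sum_(n < N) z ^+ n)).
  rewrite -(big_mkord xpredT (fun n => z ^+ n)) [leRHS](bigID (mem s)) /=.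
  rewrite -[leLHS]addr0 lerD //; last by apply: sumr_ge0 => n _; rewrite exprn_ge0 // ltW.
  rewrite -[leRHS]big_filter le_eqVlt (perm_big [seq n <- index_iota 0 N | n \in s]) ?eqxx //.
  apply: uniq_perm => //; first by rewrite filter_uniq // iota_uniq.
  move=> n; rewrite mem_filter mem_index_iota /=.
  by case: (boolP (n \in s)) => //= /sN ->.
have d0 : 0 < 1 - z by rewrite subr_gt0.
rewrite -(ler_pM2l d0) divff ?gt_eqF // -opprB mulNr -subrX1 opprB.
by rewrite gerBl exprn_ge0 // ltW.
Qed.

(** * From exit times to fixed times *)

Lemma linear_le_exp (R : realType) (D eta : R) : 0 <= D -> 0 < eta ->
  exists n0, forall n, (n0 <= n)%N -> n.+1%:R * D <= expR (n%:R * eta).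
Proof.
move=> D0 eta0; pose h := eta / 2; have h0 : 0 < h by rewrite divr_gt0.
pose c := Num.min 1 h; have c0 : 0 < c by rewrite lt_min ltr01.
have c1 : c <= 1 by rewrite ge_min lexx.
have ch : c <= h by rewrite ge_min lexx orbT.
suff [n0 _ n0P] : \forall n \near \oo, n.+1%:R * D <= expR (n%:R * eta).
  by exists n0 => n; exact: n0P.
near=> n; have Dc : D / c <= n%:R * c.
  by rewrite -ler_pdivrMr //; near: n; exact: nbhs_infty_ger.
have -> : n%:R * eta = n%:R * h + n%:R * h by rewrite /h; field.
have nch : n%:R * c <= n%:R * h by rewrite ler_wpM2l.
have e1 : n.+1%:R * c <= expR (n%:R * h).
  apply: le_trans (expR_ge1Dx _); rewrite -natr1 mulrDl mul1r addrC lerD //.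
have e2 : D / c <= expR (n%:R * h).
  by apply: le_trans (expR_ge1Dx _); lra.
rewrite expRD (_ : n.+1%:R * D = (n.+1%:R * c) * (D / c)); last first.
  by field; rewrite gt_eqF.
by apply: ler_pM => //; [rewrite mulr_ge0 // ltW|rewrite divr_ge0 // ltW].
Unshelve. all: by end_near. Qed.

Section Reduction.
Context {R : realType} {X : pmetricType R} (f : X -> X) (phi psi : X -> R).
Context (m M : R).

Lemma birkhoffS n x : birkhoff_sum f psi n.+1 x = birkhoff_sum f psi n x + psi (iter n f x).
Proof. by rewrite /birkhoff_sum big_ord_recr. Qed.

Lemma birkhoff_ge n x : (forall y, m <= psi y) -> n%:R * m <= birkhoff_sum f psi n x.
Proof.
move=> mpsi; rewrite mulr_natl -[X in _ *+ X](card_ord n) -sumr_const.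
by apply: ler_sum.
Qed.

Lemma birkhoff_le n x : (forall y, psi y <= M) -> birkhoff_sum f psi n x <= n%:R * M.
Proof.
move=> psiM; rewrite mulr_natl -[X in _ *+ X](card_ord n) -sumr_const.
by apply: ler_sum.
Qed.

Lemma birkhoffB beta n x : birkhoff_sum f (fun y => phi y - beta * psi y) n x =
  birkhoff_sum f phi n x - beta * birkhoff_sum f psi n x.
Proof. by rewrite /birkhoff_sum mulr_sumr -sumrB. Qed.

(** The first exit pins [birkhoff_sum f psi n y] to [T] up to [M]; replacing [y] by a
    point that shadows it costs [d] at each time. *)
Lemma exit_shadow (beta eps d T : R) n x y : 0 <= eps -> (forall y, psi y <= M) ->
  (forall x y, mdist x y <= eps -> `|psi x - psi y| <= d) ->
  exit_set f psi T n y -> bowen_dist f n x y <= eps ->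
  `|beta * birkhoff_sum f psi n x - beta * T| <= `|beta| * (M + n%:R * d).
Proof.
move=> eps0 psiM modd [yT Ty] xy; rewrite -mulrBr normrM ler_wpM2l //.
have := birkhoff_dist_le eps0 modd xy; rewrite ler_norml => /andP[h1 h2].
move: Ty; rewrite birkhoffS; have := psiM (iter n f y) => *.
have nd : 0 <= n%:R * d.
  by apply: le_trans (birkhoff_dist_le eps0 modd (_ : bowen_dist f n x x <= eps));
     rewrite ?subrr ?normr0 // bowen_dist_xx.
by rewrite ler_norml; apply/andP; split; lra.
Qed.

(** The sets [F n] are cut out of maximal separated sets.  Half of the decay rate
    [delta] pays for the error in [exit_shadow], and the other half makes the sum over
    the exit times a convergent geometric series. *)
Lemma induced_Q_le (beta beta' delta : R) : compact [set: X] -> continuous f ->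
  continuous psi -> 0 < m -> (forall y, m <= psi y) -> (forall y, psi y <= M) ->
  beta < beta' -> 0 < delta ->
  (forall eps, 0 < eps -> exists n0, forall n E, (n0 <= n)%N -> separated f n eps E ->
    \sum_(x <- E) expR (birkhoff_sum f (fun y => phi y - beta * psi y) n x) <=
    expR (- (n%:R * delta))) ->
  forall eps, 0 < eps -> exists T0, forall T, T0 < T ->
    (induced_Q f psi phi T eps <= (expR (beta' * T))%:E)%E.
Proof.
move=> cX cf cpsi m0 mpsi psiM bb' d0 sep eps eps0.
have M0 : 0 < M by apply: lt_le_trans m0 (le_trans (mpsi point) (psiM point)).
pose kap := delta / (2 * (`|beta| + 1)).
have kap0 : 0 < kap by rewrite divr_gt0 // mulr_gt0 // ltr_wpDl.
have kapb : `|beta| * kap <= delta / 2.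
  rewrite /kap invfM !mulrA [_ * delta]mulrC -!mulrA ler_pM2l // mulrCA ger_pMr ?invr_gt0 //.
  by rewrite ler_pdivrMr ?mul1r ?lerDl // ltr_wpDl.
have [d dd0 modd] := compact_modulus cX cpsi kap0.
pose e := Num.min eps d; have e0 : 0 < e by rewrite lt_min eps0.
have modd' x y : mdist x y <= e -> `|psi x - psi y| <= kap.
  by move=> xy; apply: modd; apply: le_trans xy _; rewrite ge_min lexx orbT.
have [n0 sepP] := sep e e0.
have /choice[E EP] := fun n => separated_spanning n cX cf e0.
pose A := expR (`|beta| * M); pose z := expR (- (delta / 2)).
have z01 : 0 < z < 1 by rewrite expR_gt0 -expR0 ltr_expR oppr_lt0 divr_gt0.
have B0 : 0 < A * (1 - z)^-1 by rewrite mulr_gt0 ?expR_gt0 // invr_gt0 subr_gt0; case/andP: z01.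
exists (Num.max (n0.+1%:R * M) (ln (A * (1 - z)^-1) / (beta' - beta))) => T.
rewrite gt_max => /andP[T1 T2].
pose F n : set X := [set x | x \in E n /\
  exists2 y, exit_set f psi T n y & bowen_dist f n x y <= e].
apply: (@le_trans _ _ (A * (1 - z)^-1 * expR (beta * T))%:E); last first.
  rewrite lee_fin -[X in X * _]lnK ?posrE // -expRD ler_expR.
  move: T2; rewrite ltr_pdivrMr ?subr_gt0 // => T2; lra.
apply: (@le_trans _ _ (\esum_(n in exit_times f psi T)
    \esum_(x in F n) (expR (birkhoff_sum f phi n x))%:E)%E).
  apply: ereal_inf_lbound; exists F => // n _ y Ty.
  have [_ spE] := EP n; have [x xE xy] := spE y Logic.I.
  exists x; first by split => //; exists y.
  by apply: le_trans xy _; rewrite ge_min lexx.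
apply: (@le_trans _ _ (\esum_(n in exit_times f psi T)
    (A * expR (beta * T) * z ^+ n)%:E)%E).
  apply: le_esum => n [n_gt0 [y [yT Ty]]]; apply: esum_le => s us sF.
  have n0n : (n0 <= n)%N.
    have := lt_le_trans (lt_trans T1 Ty) (birkhoff_le _ _ psiM).
    by rewrite ltr_pM2r // ltr_nat ltnS => /ltnW.
  have ss : separated f n e s.
    split => // x x' /sF[xE _] /sF[x'E _]; have [[_ sE] _] := EP n; exact: sE.
  apply: (@le_trans _ _ (\sum_(x <- s) expR (beta * T + `|beta| * (M + n%:R * kap)) *
     expR (birkhoff_sum f (fun y => phi y - beta * psi y) n x))).
    rewrite !big_seq; apply: ler_sum => x /sF[_ [y' y'T xy']].
    rewrite -expRD ler_expR birkhoffB.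
    have := exit_shadow beta (ltW e0) psiM modd' y'T xy'.
    by rewrite ler_norml => /andP[_]; lra.
  rewrite -mulr_sumr; apply: le_trans (ler_wpM2l (expR_ge0 _) (sepP n s n0n ss)) _.
  rewrite /A /z -expRM_natr -!expRD ler_expR.
  have : n%:R * (`|beta| * kap) <= n%:R * (delta / 2) by rewrite ler_wpM2l.
  by rewrite [_ * (M + _)]mulrDr [ `|beta| * (n%:R * _)]mulrCA; lra.
apply: esum_le => s us _; rewrite -mulr_sumr.
rewrite [X in _ <= X]mulrAC ler_wpM2l ?mulr_ge0 ?expR_ge0 //.
exact: sum_geometric_le.
Qed.

(** As [psi >= m], the interval from [S_n psi y] to [S_(n+1) psi y] contains a multiple
    of [m], and at time [n] only [n.+1 * L] multiples of [m] are concerned: a linear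
    number, which does not affect the exponential growth. *)
Lemma growth_of_induced_Q (beta : R) : compact [set: X] -> continuous f ->
  continuous psi -> 0 < m -> (forall y, m <= psi y) -> (forall y, psi y <= M) ->
  (forall eps, 0 < eps < 1 -> exists T0, forall T, T0 < T ->
    (induced_Q f psi phi T eps < (expR (beta * T))%:E)%E) ->
  forall eps eta, 0 < eps -> 0 < eta -> exists n0, forall n, (n0 <= n)%N ->
    exists2 F, spanning f n eps setT F & forall E : seq X, uniq E ->
      (forall x, x \in E -> F x) ->
      \sum_(x <- E) expR (birkhoff_sum f (fun y => phi y - beta * psi y) n x) <=
      expR (n%:R * eta).
Proof.
move=> cX cf cpsi m0 mpsi psiM QH eps eta eps0 eta0.
have M0 : 0 < M by apply: lt_le_trans m0 (le_trans (mpsi point) (psiM point)).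
pose kap := (eta / 2) / (`|beta| + 1).
have kap0 : 0 < kap by rewrite !divr_gt0 // ltr_wpDl.
have kapb : `|beta| * kap <= eta / 2.
  rewrite /kap mulrCA ger_pMr ?divr_gt0 //.
  by rewrite ler_pdivrMr ?mul1r ?lerDl // ltr_wpDl.
have [d dd0 modd] := compact_modulus cX cpsi kap0.
pose e := Num.min (Num.min eps d) (1 / 2).
have e0 : 0 < e by rewrite !lt_min eps0 dd0 divr_gt0.
have e1 : e < 1 by rewrite gt_min; apply/orP; right; rewrite ltr_pdivrMr // mul1r ltr1n.
have modd' x y : mdist x y <= e -> `|psi x - psi y| <= kap.
  by move=> xy; apply: modd; apply: le_trans xy _; rewrite !ge_min lexx orbT.
have [T0 QT0] : exists T0, forall T, T0 < T ->
    (induced_Q f psi phi T e < (expR (beta * T))%:E)%E by apply: QH; rewrite e0.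
have /choice[Fs FsP] : forall T, exists F : nat -> set X, T0 < T ->
    (forall n, exit_times f psi T n -> spanning f n e (exit_set f psi T n) (F n)) /\
    (\esum_(n in exit_times f psi T)
      \esum_(x in F n) (expR (birkhoff_sum f phi n x))%:E < (expR (beta * T))%:E)%E.
  move=> T; have [T0T|_] := ltP T0 T; last by exists (fun=> set0).
  have [_ [F Fsp <-] FQ] := ereal_inf_lt (QT0 T T0T).
  by exists F.
have [L LM] : exists L : nat, M <= L%:R * m.
  exists (Num.truncn (M / m)).+1; rewrite -ler_pdivrMr //; apply: ltW.
  by rewrite truncnS_gt.
pose D := L%:R * expR (`|beta| * M).
have D0 : 0 <= D by rewrite mulr_ge0 ?expR_ge0.
have [n1 n1P] := linear_le_exp D0 (divr_gt0 eta0 (ltr0n R 2)).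
have [n2 n2P] : exists n2 : nat, forall n, (n2 <= n)%N -> T0 < n%:R * m.
  exists (Num.truncn (`|T0| / m)).+1 => n nn.
  apply: le_lt_trans (ler_norm _) _; rewrite -ltr_pdivrMr //.
  by apply: lt_le_trans (truncnS_gt _) _; rewrite ler_nat.
exists (maxn 1 (maxn n1 n2)) => n; rewrite !geq_max => /and3P[n_gt0 nn1 nn2].
pose N := (n.+1 * L)%N.
pose T (i : nat) := i%:R * m.
pose near i x := Fs (T i) n x /\
  exists2 y, exit_set f psi (T i) n y & bowen_dist f n x y <= e.
pose good i := T0 < T i /\ exit_times f psi (T i) n.
exists [set x | exists i : 'I_N, good i /\ near i x].
  move=> y _; have nmS : n%:R * m <= birkhoff_sum f psi n y by exact: birkhoff_ge.
  have S0 : 0 < birkhoff_sum f psi n y.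
    by apply: lt_le_trans nmS; rewrite mulr_gt0 // ltr0n.
  have ex : exists i : nat, birkhoff_sum f psi n y <= T i.
    exists (Num.truncn (birkhoff_sum f psi n y / m)).+1; rewrite /T -ler_pdivrMr //.
    by apply: ltW; rewrite truncnS_gt.
  have [i iS imin] := ex_minnP ex.
  have iT : T i < birkhoff_sum f psi n.+1 y.
    case: i iS imin => [|i] iS imin; first by move: iS; rewrite /T mul0r leNgt S0.
    have : T i < birkhoff_sum f psi n y.
      by rewrite ltNge; apply/negP => /imin; rewrite ltnn.
    by rewrite birkhoffS /T -natr1 mulrDl mul1r; have := mpsi (iter n f y); lra.
  have ex_y : exit_set f psi (T i) n y by split.
  have iN : (i < N)%N.
    have : T i < n.+1%:R * (L%:R * m).
      by apply: lt_le_trans iT (le_trans (birkhoff_le _ _ psiM) _); rewrite ler_wpM2l.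
    by rewrite mulrA -natrM ltr_pM2r // ltr_nat.
  have T0i : T0 < T i by apply: lt_le_trans (n2P n nn2) (le_trans nmS iS).
  have exn : exit_times f psi (T i) n by split => //; exists y.
  have [spF _] := FsP _ T0i; have [x Fx xy] := spF n exn y ex_y.
  exists x; last by apply: le_trans xy _; rewrite !ge_min lexx.
  by exists (Ordinal iN); split => //; split => //; exists y.
move=> E uE EF.
have /choice[io ioP] : forall x, exists i : option 'I_N,
    x \in E -> exists2 j, i = Some j & good j /\ near j x.
  move=> x; have [xE|xE] := boolP (x \in E); last by exists None.
  by have [i ih] := EF x xE; exists (Some i) => _; exists i.
have part (i : 'I_N) : \sum_(x <- E | io x == Some i)
    expR (birkhoff_sum f (fun y => phi y - beta * psi y) n x) <=
    expR (`|beta| * M) * expR (n%:R * (eta / 2)).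
  rewrite -big_filter; set Ei := [seq x <- E | io x == Some i].
  have EiP x : x \in Ei -> good i /\ near i x.
    rewrite mem_filter => /andP[/eqP iox xE]; have [j] := ioP x xE.
    by rewrite iox => -[<-].
  case EiE : Ei => [|x0 s]; first by rewrite big_nil mulr_ge0 ?expR_ge0.
  have [[T0i exn] _] := EiP x0 ltac:(by rewrite EiE mem_head); rewrite -EiE.
  have [_ sumF] := FsP _ T0i.
  have uEi : uniq Ei by rewrite filter_uniq.
  have {sumF} sumEi : \sum_(x <- Ei) expR (birkhoff_sum f phi n x) <= expR (beta * T i).
    rewrite -lee_fin; apply: le_trans (ltW sumF).
    apply: (@le_trans _ _ (\esum_(x in Fs (T i) n) (expR (birkhoff_sum f phi n x))%:E)%E).
      rewrite -sumEFin; apply: sum_le_esum => // x /EiP[_ []] //.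
    have := @sum_le_esum R nat (exit_times f psi (T i))
      (fun n => \esum_(x in Fs (T i) n) (expR (birkhoff_sum f phi n x))%:E)%E [:: n] isT.
    by rewrite big_seq1; apply => k; rewrite inE => /eqP ->.
  apply: (@le_trans _ _ (\sum_(x <- Ei) expR (`|beta| * (M + n%:R * kap) - beta * T i) *
     expR (birkhoff_sum f phi n x))).
    rewrite !big_seq; apply: ler_sum => x /EiP[_ [_ [y yT xy]]].
    rewrite -expRD ler_expR birkhoffB.
    have := exit_shadow beta (ltW e0) psiM modd' yT xy.
    by rewrite ler_norml => /andP[]; lra.
  rewrite -mulr_sumr; apply: le_trans (ler_wpM2l (expR_ge0 _) sumEi) _.
  rewrite -!expRD ler_expR.
  have : n%:R * (`|beta| * kap) <= n%:R * (eta / 2) by rewrite ler_wpM2l.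
  by rewrite [_ * (M + _)]mulrDr [ `|beta| * (n%:R * _)]mulrCA; lra.
have -> : \sum_(x <- E) expR (birkhoff_sum f (fun y => phi y - beta * psi y) n x) =
    \sum_(i < N) \sum_(x <- E | io x == Some i)
      expR (birkhoff_sum f (fun y => phi y - beta * psi y) n x).
  rewrite (exchange_big_dep xpredT) //= !big_seq; apply: eq_bigr => x xE.
  have [j -> _] := ioP x xE; rewrite (bigD1 j) //= big1 ?addr0 //.
  by move=> i /andP[/eqP[->]]; rewrite eqxx.
apply: (@le_trans _ _ (\sum_(i < N) expR (`|beta| * M) * expR (n%:R * (eta / 2)))).
  by apply: ler_sum => i _; exact: part.
rewrite sumr_const card_ord -[leLHS]mulr_natl /N natrM.
have := n1P n nn1; set w := expR (n%:R * _) => h.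
have -> : expR (n%:R * eta) = w * w.
  by rewrite -expRD; congr expR; field.
have -> : n.+1%:R * L%:R * (expR (`|beta| * M) * w) = (n.+1%:R * D) * w.
  by rewrite /D !mulrA.
by rewrite ler_wpM2r // expR_ge0.
Qed.

End Reduction.

(** * The variational principle *)

Lemma ereal_between (R : realType) (a b : \bar R) : (a < b)%E ->
  exists r : R, (a < r%:E)%E /\ (r%:E < b)%E.
Proof.
case: a => [a| |]; case: b => [b| |] //.
- rewrite lte_fin => ab; exists ((a + b) / 2); rewrite !lte_fin.
  by split; lra.
- by move=> _; exists (a + 1); rewrite ltry lte_fin ltrDl.
- by move=> _; exists (b - 1); rewrite ltNyr lte_fin gtrBl.
- by move=> _; exists 0; rewrite ltNyr ltry.
Qed.

Section Pressure.
Context {R : realType} {X : pmetricType R} (f : X -> X) (phi psi : X -> R).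

Definition scale_pressure (eps : R) : \bar R :=
  limf_esup (fun T : R => (T^-1)%:E * lne (induced_Q f psi phi T eps))%E (pinfty_nbhs R).

Lemma induced_Q_ge0 T eps : (0 <= induced_Q f psi phi T eps)%E.
Proof.
apply: le_ereal_inf_tmp => _ [F _ <-]; apply: esum_ge0 => n _; apply: esum_ge0 => x _.
by rewrite lee_fin expR_ge0.
Qed.

Lemma induced_Q_antitone T eps eps' : eps <= eps' ->
  (induced_Q f psi phi T eps' <= induced_Q f psi phi T eps)%E.
Proof.
move=> ee'; apply: le_ereal_inf => _ [F FP <-]; exists F => // n Tn y Ty.
by have [x Fx xy] := FP n Tn y Ty; exists x => //; exact: le_trans ee'.
Qed.

(** The factor [T^-1] preserves the order only for [T > 0], so the levels are
    restricted to positive ones. *)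
Lemma scale_pressure_antitone eps eps' : eps <= eps' ->
  (scale_pressure eps' <= scale_pressure eps)%E.
Proof.
move=> ee'; apply: le_ereal_inf_tmp => _ [V VF <-].
apply: (@le_trans _ _ (ereal_sup [set ((T^-1)%:E * lne (induced_Q f psi phi T eps'))%E
    | T in V `&` [set T | 0 < T]])).
  apply: ereal_inf_lbound; exists (V `&` [set T | 0 < T]) => //.
  by apply: filterI => //; exists 0.
apply: ge_ereal_sup => _ [T [VT /= T0] <-].
apply: (@le_trans _ _ ((T^-1)%:E * lne (induced_Q f psi phi T eps))%E).
  rewrite lee_wpmul2l ?lee_fin ?invr_ge0 ?(ltW T0) //.
  by rewrite lee_lne ?in_itv /= ?induced_Q_ge0 ?leey // induced_Q_antitone.
by apply: ereal_sup_ubound; exists T.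
Qed.

(** The limit in the scale is a supremum by monotonicity. *)
Lemma induced_pressureE :
  induced_pressure f psi phi = ereal_sup (scale_pressure @` `]0, 1[%classic).
Proof.
apply: cvg_lim => //.
apply: (@nonincreasing_at_right_cvge _ scale_pressure 0 (BLeft 1)).
  by rewrite bnd_simp.
by move=> e e' _ _ ee'; exact: scale_pressure_antitone.
Qed.

Lemma scale_pressure_le (beta eps : R) :
  (exists T0, forall T, T0 < T -> (induced_Q f psi phi T eps <= (expR (beta * T))%:E)%E) ->
  (scale_pressure eps <= beta%:E)%E.
Proof.
move=> [T0 H].
apply: (@le_trans _ _ (ereal_sup [set ((T^-1)%:E * lne (induced_Q f psi phi T eps))%E
    | T in [set T | Num.max 0 T0 < T]])).
  apply: ereal_inf_lbound; exists [set T | Num.max 0 T0 < T] => //.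
  by exists (Num.max 0 T0); split => //; exact: num_real.
apply: ge_ereal_sup => _ [T /= + <-]; rewrite gt_max => /andP[T_gt0 T0T].
rewrite lee_pdivrMl // -EFinM mulrC -[X in X%:E]expRK -lne_EFin ?expR_gt0 //.
by rewrite lee_lne ?in_itv /= ?induced_Q_ge0 ?leey ?lee_fin ?expR_ge0 ?H.
Qed.

Lemma scale_pressure_lt (beta eps : R) : (scale_pressure eps < beta%:E)%E ->
  exists T0, forall T, T0 < T -> (induced_Q f psi phi T eps < (expR (beta * T))%:E)%E.
Proof.
move=> /ereal_inf_lt[_ [V [T0 [_ T0V]] <-] supV].
exists (Num.max 0 T0) => T; rewrite gt_max => /andP[T_gt0 T0T].
have : ((T^-1)%:E * lne (induced_Q f psi phi T eps) < beta%:E)%E.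
  apply: le_lt_trans supV; apply: ereal_sup_ubound; exists T => //; exact: T0V.
rewrite lte_pdivrMl // -EFinM mulrC -[X in X%:E]expRK -lne_EFin ?expR_gt0 //.
by rewrite lte_lne ?in_itv /= ?induced_Q_ge0 ?leey ?lee_fin ?expR_ge0.
Qed.

End Pressure.

Section Value.
Context {R : realType} {X : pmetricType R} (f : X -> X) (phi psi : X -> R).
Implicit Types (nu : probability (borel X) R).

Lemma entropy_wrt_le_ks nu k (P : 'I_k -> set X) : finite_partition P ->
  ((entropy_wrt nu f P)%:E <= ks_entropy nu f)%E.
Proof. by move=> pP; apply: ereal_sup_ubound; exists k, P. Qed.

(** Clear the positive denominator; an affine function of the entropy is bounded as
    soon as it is bounded for each partition. *)
Lemma ratio_le nu (beta : R) : bounded_borel phi -> bounded_borel psi ->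
  0 < mean nu psi ->
  (ks_entropy nu f / \int[nu]_x (psi x)%:E +
    \int[nu]_x (phi x)%:E / \int[nu]_x (psi x)%:E <= beta%:E)%E <->
  (forall k (P : 'I_k -> set X), finite_partition P ->
    entropy_wrt nu f P + mean nu (fun x => phi x - beta * psi x) <= 0).
Proof.
move=> bphi bpsi psi0; rewrite !meanE // inver gt_eqF // -EFinM.
have -> : mean nu (fun x => phi x - beta * psi x) = mean nu phi - beta * mean nu psi.
  rewrite -mulNr -meanZ // -meanD //; last exact: bounded_borelZ.
  by congr mean; apply/funext => x; rewrite mulNr.
rewrite -leeBrDr // -EFinB lee_pdivrMr // -EFinM mulrBl mulfVK ?gt_eqF //.
split=> [le k P pP|H].
  by have := le_trans (entropy_wrt_le_ks nu pP) le; rewrite lee_fin; lra.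
by apply: ge_ereal_sup => _ [k [P pP ->]]; rewrite lee_fin; have := H k P pP; lra.
Qed.

End Value.

Unset Implicit Arguments.

Theorem theorem1p1 (R : realType) (X : pmetricType R) (f : X -> X)
    (phi psi : X -> R) :
  compact [set: X] -> continuous f ->
  continuous phi -> continuous psi -> (forall x, 0 < psi x) ->
  induced_pressure f psi phi =
  ereal_sup [set (ks_entropy nu f / \int[nu]_x (psi x)%:E
                  + \int[nu]_x (phi x)%:E / \int[nu]_x (psi x)%:E)%E
            | nu in invariant_measures f].
Proof.
move=> cX cf cphi cpsi psi0.
have [m m0 mpsi] := compact_pos_lbound cX cpsi psi0.
have [M _ psiM'] := compact_bounded_fun cX cpsi.
have psiM y : psi y <= M by apply: le_trans (ler_norm _) (psiM' y).
have bphi := continuous_bounded_borel cX cphi.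
have bpsi := continuous_bounded_borel cX cpsi.
have meanpsi (nu : probability (borel X) R) : m <= mean nu psi.
  by rewrite -(mean_cst nu m); apply: le_mean => //; exact: bounded_borel_cst.
have meanpsi0 nu : 0 < mean nu psi by apply: lt_le_trans (meanpsi nu).
have cg beta : continuous (fun y => phi y - beta * psi y).
  move=> x; apply: cvgB; first exact: cphi.
  by apply: cvgMr; exact: cpsi.
set s := ereal_sup _; apply/eqP; rewrite eq_le; apply/andP; split; rewrite leNgt; apply/negP.
- move=> /ereal_between[b2 [/ereal_between[b1 [sb1 b12]] b2P]].
  rewrite lte_fin in b12.
  pose b := (b1 + b2) / 2.
  have b1b : b1 < b by rewrite /b; lra.
  have bb2 : b < b2 by rewrite /b; lra.
  pose delta := (b - b1) * m / 2.
  have delta0 : 0 < delta by rewrite divr_gt0 // mulr_gt0 // subr_gt0.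
  have free nu k (P : 'I_k -> set X) : invariant_measures f nu -> finite_partition P ->
      entropy_wrt nu f P + mean nu (fun y => phi y - b * psi y) <= - (2 * delta).
    move=> inv pP.
    have le_b1 := ltW (le_lt_trans (ereal_sup_ubound (ex_intro2 _ _ nu inv erefl)) sb1).
    have := (ratio_le f b1 bphi bpsi (meanpsi0 nu)).1 le_b1 k P pP.
    have -> : mean nu (fun y => phi y - b * psi y) =
        mean nu (fun y => phi y - b1 * psi y) + (- (b - b1)) * mean nu psi.
      rewrite -meanZ // -meanD; [|exact: continuous_bounded_borel|exact: bounded_borelZ].
      by congr mean; apply/funext => y; ring.
    have := ler_wpM2l (ltW (_ : 0 < b - b1)) (meanpsi nu); rewrite subr_gt0 => /(_ b1b).
    by rewrite /delta; lra.
  have sep eps : 0 < eps -> exists n0, forall n E, (n0 <= n)%N -> separated f n eps E ->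
      \sum_(x <- E) expR (birkhoff_sum f (fun y => phi y - b * psi y) n x) <=
      expR (- (n%:R * delta)).
    move=> eps0; apply: contrapT => H.
    have lt_delta : - (3 * delta / 2) < - delta by lra.
    have [|nu [inv [k [P [pP]]]]] := entropy_ge_separated cX cf (cg b) eps0 lt_delta.
    + move=> n0; apply: contrapT => nH; apply: H; exists n0 => n E n0n sE.
      rewrite leNgt; apply/negP => lt; apply: nH; exists n, E; split => //.
      by rewrite mulrN ltW.
    + by have := free nu k P inv pP; lra.
  have Qle := induced_Q_le cX cf cpsi m0 mpsi psiM bb2 delta0 sep.
  move: b2P; rewrite induced_pressureE ltNge => /negP; apply.
  apply: ge_ereal_sup => _ [e + <-]; rewrite /= in_itv /= => /andP[e0 _].
  by apply: scale_pressure_le; exact: Qle.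
- move=> /ereal_between[b [Pb bs]].
  have growth := growth_of_induced_Q (phi := phi) (beta := b) cX cf cpsi m0 mpsi psiM _.
  move: bs; rewrite ltNge => /negP; apply; apply: ge_ereal_sup => _ [nu inv <-].
  apply/(ratio_le f b bphi bpsi (meanpsi0 nu)) => k P pP.
  apply: (entropy_le_growth cX cf (cg b) inv pP); apply: growth => e /andP[e0 e1].
  apply: scale_pressure_lt; apply: le_lt_trans Pb; rewrite induced_pressureE.
  by apply: ereal_sup_ubound; exists e => //=; rewrite in_itv /= e0.
Qed.
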